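(* Let $m$ be an integer. Let $c_1\le\dots\le c_m$ be integers, and suppose $X_1,\dots,X_m$ are independent random variables such that $X_i$ is equal to $c_i$ with probability $r\in(0,1)$, and $X_i$ is zero otherwise. Let $g:\mathbb N\to\mathbb R$ be an increasing positive function such that $g(m)\to\infty$ and $g(m)=o(\log m)$. Suppose $c_m=O\big(m^{2/3}g(m)^{-1}\big)$, $\sum_{i=1}^m c_i^2=O\big(m^{4/3}g(m)^{-1/2}\big)$ and $c_i=1$ for all $i\le\rho m$, where $\rho\in(0,1)$ is independent of $m$. Let $\ell=\ell(m,g)>0$ be the smallest integer such that $m^{2/3}g(m)^{-2^\ell}=o(m^{1/4})$. If for all $1\le k\le\ell$ we have $|\{i:c_i\in\mathcal I_k(g)\}|=\Omega\big(g(m)^{3\cdot 2^{k-1}}\big)$, then a local limit theorem holds for $S_m=\sum_{i=1}^m X_i$.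
   Context: For an increasing positive function $g$ and each integer $k\ge0$, the interval $\mathcal I_k(g)$ is $$\mathcal I_k(g)=\left[\frac{\vartheta m^{2/3}}{2g(m)^{2^k}},\frac{\vartheta m^{2/3}}{g(m)^{2^k}}\right],$$ where $\vartheta>0$ is a fixed large constant (independent of $m$). Write $\mu_m=\mathrm E[S_m]$ and $\sigma_m^2=\mathrm{Var}(S_m)$. One says that a local limit theorem holds for $S_m$ if for every integer $a\in\mathbb Z$: $$\Pr[S_m=a]=\frac{1}{\sqrt{2\pi}\,\sigma_m}\exp\Big(-\frac{(a-\mu_m)^2}{2\sigma_m^2}\Big)+o(\sigma_m^{-1}).$$ All asymptotic notation and limits are as $m\to\infty$. *)

(* Defs.v *)
From HB Require Import structures.
From mathcomp Require Import all_boot all_order all_algebra.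
From mathcomp Require Import all_classical all_reals all_analysis.

Set Implicit Arguments.
Unset Strict Implicit.
Unset Printing Implicit Defensive.

Import Order.TTheory GRing.Theory Num.Theory.
Import numFieldNormedType.Exports.

Local Open Scope classical_set_scope.
Local Open Scope ring_scope.

Definition mutually_independent (d : measure_display) (T : measurableType d)
    (R : realType) (P : probability T R) (I : finType) (X : I -> {RV P >-> R}) :=
  forall (J : {set I}) (A : I -> set R), (forall i, measurable (A i)) ->
    P (\bigcap_(i in [set` J]) X i @^-1` A i) =
    (\prod_(i in J) P (X i @^-1` A i))%E.

(* The law r * delta_x + (1 - r) * delta_0. It is stated on all measurable sets
   rather than on the atoms x and 0, so that it is also correct when x = 0. *)
Definition two_point_law (d : measure_display) (T : measurableType d)
    (R : realType) (P : probability T R) (r x : R) (X : {RV P >-> R}) :=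
  forall A : set R, measurable A ->
    P (X @^-1` A) = (r%:E * dirac x A + (1 - r)%:E * dirac (0%R : R) A)%E.

Definition calI (R : realType) (theta : R) (g : nat -> R) (k m : nat)
    : interval R :=
  `[theta * m%:R `^ (2 / 3) / (2 * g m ^+ (2 ^ k)),
    theta * m%:R `^ (2 / 3) / g m ^+ (2 ^ k)].

(* l is the smallest positive integer such that
   m^(2/3) g(m)^(-2^l) <= delta(m) m^(1/4).
   "Smallest l such that m^(2/3) g(m)^(-2^l) = o(m^(1/4))" is this condition
   for a sequence delta tending to 0: l depends on m, and there is in general
   no smallest function of m satisfying the little-o bound, so "smallest" is
   relative to the rate delta witnessing it. Since g(m) > 1 eventually, every
   positive function l of m satisfying the little-o bound eventually arises in
   this way, with delta the ratio of the two sides. *)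
Definition is_ell (R : realType) (g delta : nat -> R) (m l : nat) :=
  let small j := m%:R `^ (2 / 3) / g m ^+ (2 ^ j) <= delta m * m%:R `^ (1 / 4) in
  [/\ (0 < l)%N, small l & forall j, (0 < j)%N -> small j -> (l <= j)%N].

(* The error term o(1/sigma_m) is uniform in the integer a, which may
   therefore depend on m. *)
Definition local_limit_theorem (R : realType) (F : set_system nat)
    (d : nat -> measure_display) (T : forall m, measurableType (d m))
    (P : forall m, probability (T m) R) (S : forall m, T m -> R) :=
  let mu m := fine 'E_(P m)[S m]%E in
  let sigma m := Num.sqrt (fine 'V_(P m)[S m]%E) in
  forall e : R, 0 < e -> \forall m \near F, forall a : int,
    `| fine (P m (S m @^-1` [set a%:~R]))
       - (Num.sqrt (2 * pi) * sigma m)^-1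
         * expR (- (a%:~R - mu m) ^+ 2 / (2 * sigma m ^+ 2)) | <= e / sigma m.

(* Main.v *)
Require Import Defs.
From HB Require Import structures.
From mathcomp Require Import all_boot all_order all_algebra.
From mathcomp Require Import all_classical all_reals all_analysis.
From mathcomp Require Import measurable_realfun ring lra.

(* Let phi be the characteristic function of S_m - mu_m. By Fourier inversion on
   the lattice and for the Gaussian, it is enough that |phi(t) -
   exp(-sigma^2 t^2 / 2)| has integral o(1/sigma) over |t| <= pi, the Gaussian
   tail being negligible. Fix a large constant A.
   For |t| <= A/sigma, a Taylor expansion of each factor bounds the difference
   by 3 |t|^3 sum c_i^3 = O(A^3 c_m / sigma). The interval I_1 forces
   sigma >> m^(2/3) g^(-1/2), so c_m / sigma = O(g^(-1/2)) tends to 0.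
   For A/sigma <= |t| <= pi one uses
   |phi(t)| <= exp(- r (1 - r) sum (1 - cos (c_i t))):
   - while |t| c_m <= 1 this is at most exp(- sigma^2 t^2 / 4);
   - from there to m^(-1/4), the first interval I_k with |t| max I_k <= 1 alone
     gives exp(- const m^(2/3) |t|), whatever k is;
   - for |t| >= m^(-1/4) the indices with c_i = 1 give exp(- const sqrt m).
   As sigma = O(m^(2/3)), the first two contribute O(exp(- const A) / sigma) and
   the third o(1/sigma). *)

Set Implicit Arguments.
Unset Strict Implicit.
Unset Printing Implicit Defensive.
Import Order.TTheory GRing.Theory Num.Theory.
Import numFieldNormedType.Exports.

Local Open Scope classical_set_scope.
Local Open Scope ring_scope.

(** * Comparison of derivatives and Taylor bounds *)

(** A mean value inequality: [g - f] and [g + f] have nonnegative derivatives. It serves below in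
    place of integral estimates, with [g] a primitive of the bound. *)
Lemma ler_dist_derive (R : realType) (f g f' g' : R -> R) (a b : R) :
  a <= b ->
  {within `[a, b], continuous f} -> {within `[a, b], continuous g} ->
  (forall x, a < x < b -> is_derive x 1 f (f' x)) ->
  (forall x, a < x < b -> is_derive x 1 g (g' x)) ->
  (forall x, a < x < b -> `|f' x| <= g' x) ->
  `|f b - f a| <= g b - g a.
Proof.
move=> ab cf cg df dg fg.
have aab : a \in `[a, b] by rewrite in_itv /= lexx.
have bab : b \in `[a, b] by rewrite in_itv /= ab lexx.
have mono (h h' : R -> R) : {within `[a, b], continuous h} ->
    (forall x, a < x < b -> is_derive x 1 h (h' x)) ->
    (forall x, a < x < b -> 0 <= h' x) -> h a <= h b.
  move=> ch dh h0; apply: (@ger0_derive1_le_cc R h a b) => // x;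
    rewrite in_itv /= => xab; have dhx := dh _ xab; first exact: ex_derive.
  by rewrite derive1E derive_val; exact: h0.
have H1 : g a - f a <= g b - f b.
  apply: (mono (g - f) (g' - f')) => [||x xab].
  - by move=> x; apply: cvgB; [exact: cg | exact: cf].
  - by move=> x xab; apply: is_deriveB; [exact: dg | exact: df].
  - by rewrite subr_ge0 (le_trans (ler_norm _)) // fg.
have H2 : g a + f a <= g b + f b.
  apply: (mono (g + f) (g' + f')) => [||x xab].
  - by move=> x; apply: cvgD; [exact: cg | exact: cf].
  - by move=> x xab; apply: is_deriveD; [exact: dg | exact: df].
  - have := fg _ xab; rewrite ler_norml => /andP[+ _].
    by rewrite -subr_ge0 opprK addrC.
by rewrite ler_norml; apply/andP; split; lra.
Qed.

Lemma ler_dist_derive0 (R : realType) (f g f' g' : R -> R) (x : R) :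
  0 <= x -> g 0 = 0 ->
  (forall y : R, is_derive y 1 f (f' y)) ->
  (forall y : R, is_derive y 1 g (g' y)) ->
  (forall y, 0 <= y -> `|f' y| <= g' y) -> `|f x - f 0| <= g x.
Proof.
move=> x0 g0 df dg fg; have -> : g x = g x - g 0 by rewrite g0 subr0.
apply: (@ler_dist_derive R f g f' g' 0 x x0).
- by apply: derivable_within_continuous => y _; have ? := df y; exact: ex_derive.
- by apply: derivable_within_continuous => y _; have ? := dg y; exact: ex_derive.
- by move=> y /andP[/ltW y0 _]; exact: fg.
Qed.

Lemma is_derive_expn_div (R : realType) (n : nat) (k x : R) :
  is_derive x 1 (fun y : R => y ^+ n.+1 / k) (n.+1%:R * x ^+ n / k).
Proof.
have -> : (fun y : R => y ^+ n.+1 / k) = k^-1 *: (@id R) ^+ n.+1.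
  by apply/funext => y; rewrite !fctE mulrC.
by apply: is_derive_eq; rewrite /= ![_ *: _]mulrC mul1r.
Qed.

Section trigonometric_bounds.
Context {R : realType}.
Implicit Type x : R.

(** The bounds up to [cos_sub_le] follow one from another: the derivative of each is controlled by
    its predecessor, and parity reduces to nonnegative arguments. *)
Lemma sin_le_abs x : `|sin x| <= `|x|.
Proof.
have H (y : R) : 0 <= y -> `|sin y| <= y.
  move=> y0; have := @ler_dist_derive0 R sin id cos (cst 1) y y0.
  by rewrite sin0 subr0; apply=> // z _; exact: cos_max.
have [x0|/ltW x0] := leP 0 x; first by rewrite (ger0_norm x0) H.
by rewrite -normrN -sinN (ler0_norm x0) H ?oppr_ge0.
Qed.

Lemma one_sub_cos_le x : 1 - cos x <= x ^+ 2 / 2.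
Proof.
have H (y : R) : 0 <= y -> 1 - cos y <= y ^+ 2 / 2.
  move=> y0.
  have := @ler_dist_derive0 R cos (fun z => z ^+ 2 / 2) (fun z => - sin z) id y y0.
  rewrite expr0n /= mul0r cos0 => /(_ erefl) h.
  rewrite (le_trans (ler_norm _)) // distrC; apply: h => //.
  - by move=> z; apply: is_derive_eq (is_derive_expn_div 1 2 z) _; field.
  - by move=> z z0; rewrite normrN (le_trans (sin_le_abs z)) ?ger0_norm.
by have := H `|x| (normr_ge0 _); rewrite cos_norm real_normK ?num_real.
Qed.

Lemma sin_sub_le x : `|sin x - x| <= `|x| ^+ 3 / 6.
Proof.
have H (y : R) : 0 <= y -> `|sin y - y| <= y ^+ 3 / 6.
  move=> y0.
  have := @ler_dist_derive0 R (fun z => sin z - z) (fun z => z ^+ 3 / 6)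
    (fun z => cos z - 1) (fun z => z ^+ 2 / 2) y y0.
  rewrite expr0n /= mul0r sin0 !subr0; apply=> //.
  - by move=> z; apply: is_derive_eq (is_derive_expn_div 2 6 z) _; field.
  - by move=> z z0; rewrite distrC ger0_norm ?one_sub_cos_le // subr_ge0 cos_le1.
have [x0|/ltW x0] := leP 0 x; first by rewrite (ger0_norm x0) H.
have -> : sin x - x = - (sin (- x) - - x) by rewrite sinN; ring.
by rewrite normrN (ler0_norm x0) H ?oppr_ge0.
Qed.

Lemma cos_sub_le x : `|cos x - 1 + x ^+ 2 / 2| <= x ^+ 4 / 24.
Proof.
have H (y : R) : 0 <= y -> `|cos y - 1 + y ^+ 2 / 2| <= y ^+ 4 / 24.
  move=> y0.
  have := @ler_dist_derive0 R (fun z => cos z - 1 + z ^+ 2 / 2)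
    (fun z => z ^+ 4 / 24) (fun z => z - sin z) (fun z => z ^+ 3 / 6) y y0.
  rewrite !expr0n /= !mul0r cos0 subrr addr0 subr0; apply=> //.
  - move=> z; have dc : is_derive z 1 (fun z : R => cos z - 1) (- sin z).
      by apply: is_derive_eq; rewrite subr0.
    apply: is_derive_eq (is_deriveD dc (is_derive_expn_div 1 2 z)) _.
    by field.
  - by move=> z; apply: is_derive_eq (is_derive_expn_div 3 24 z) _; field.
  - by move=> z z0; rewrite distrC (le_trans (sin_sub_le z)) ?ger0_norm.
have := H `|x| (normr_ge0 _); rewrite cos_norm real_normK ?num_real //.
by rewrite -normrX (@ger0_norm _ (x ^+ 4)) ?exprn_even_ge0.
Qed.

(** For |x| <= 1 the quartic error is below the cubic one; for |x| >= 1 the quantity lies between 0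
    and x^2/2. Validity for every x spares a condition on t c_i later. *)
Lemma cos_taylor2 x : `|cos x - 1 + x ^+ 2 / 2| <= `|x| ^+ 3.
Proof.
have [x1|/ltW x1] := leP `|x| 1.
  rewrite (le_trans (cos_sub_le x)) //.
  have -> : x ^+ 4 = `|x| ^+ 3 * `|x|.
    by rewrite -exprSr -normrX ger0_norm ?exprn_even_ge0.
  have : `|x| ^+ 3 * `|x| <= `|x| ^+ 3 by rewrite ler_piMr // exprn_ge0.
  have : 0 <= `|x| ^+ 3 by rewrite exprn_ge0.
  by lra.
have h0 : 0 <= cos x - 1 + x ^+ 2 / 2 by have := one_sub_cos_le x; lra.
have := cos_le1 x; rewrite ger0_norm //.
have : `|x| ^+ 2 <= `|x| ^+ 3 by apply: ler_weXn2l.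
have : 0 <= `|x| ^+ 3 by rewrite exprn_ge0.
by rewrite real_normK ?num_real //; lra.
Qed.

(** The quartic error is at most x^2/24 here, and 1/2 - 1/24 >= 1/4. *)
Lemma one_sub_cos_ge x : `|x| <= 1 -> x ^+ 2 / 4 <= 1 - cos x.
Proof.
move=> x1; have := cos_sub_le x; rewrite ler_norml => /andP[_].
have : x ^+ 2 <= 1 by rewrite -real_normK ?num_real // exprn_ile1.
have : x ^+ 4 = x ^+ 2 * x ^+ 2 by rewrite -exprD.
by have := sqr_ge0 x; nra.
Qed.

(** With z = kx^2/2 the quantity lies between 0 and min(z, z^2); z^2 is used for |x| <= 1 and z
    beyond. *)
Lemma expRN_taylor1 k x : 0 <= k <= 1 ->
  `|expR (- (k * x ^+ 2 / 2)) - 1 + k * x ^+ 2 / 2| <= `|x| ^+ 3.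
Proof.
move=> /andP[k0 k1]; pose z := k * x ^+ 2 / 2; rewrite -/z.
have z0 : 0 <= z by rewrite /z divr_ge0 // mulr_ge0 ?sqr_ge0.
have zx : z <= `|x| ^+ 2 / 2.
  rewrite real_normK ?num_real // ler_pM2r ?invr_gt0 //.
  by rewrite ler_piMl ?sqr_ge0.
have h0 : 0 <= expR (- z) - 1 + z by have := expR_ge1Dx (- z); lra.
rewrite ger0_norm //.
have e1 : expR (- z) <= 1 by rewrite expR_le1; lra.
have zle : expR (- z) - 1 + z <= z by lra.
have zsq : expR (- z) - 1 + z <= z ^+ 2.
  have [z1|z1] := leP z 1; last first.
    by apply: (le_trans zle); rewrite expr2 ler_peMl // ltW.
  have : expR (- z) * expR z = 1 by rewrite mulrC expRxMexpNx_1.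
  have := expR_ge1Dx z; have := expR_gt0 (- z); nra.
have x20 : 0 <= `|x| ^+ 2 by rewrite exprn_ge0.
have [x1|/ltW x1] := leP `|x| 1.
  apply: (le_trans zsq).
  have : `|x| ^+ 2 * `|x| ^+ 2 <= `|x| ^+ 3.
    by rewrite -exprD ler_wiXn2l.
  by nra.
have : `|x| ^+ 2 <= `|x| ^+ 3 by apply: ler_weXn2l.
by lra.
Qed.

End trigonometric_bounds.

(** * Means of functions of a sum of Bernoulli variables *)

Section bern_mean.
Context {R : realType}.
Variable r : R.
Hypothesis r01 : 0 < r < 1.
Implicit Types (h : R -> R) (s : seq R) (x y t u : R).

(* The mean of h (y + Y), for Y a sum of independent variables that are equal to
   x with probability r and to 0 otherwise, x ranging over s. *)
Fixpoint bern_mean h s y : R :=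
  if s is x :: s' then r * bern_mean h s' (y + x) + (1 - r) * bern_mean h s' y
  else h y.

Local Notation v := (r * (1 - r)).

Let r_ge0 : 0 <= r. Proof. by case/andP: r01 => /ltW. Qed.
Let r1_ge0 : 0 <= 1 - r. Proof. by case/andP: r01 => _ /ltW; rewrite subr_ge0. Qed.
Let v_ge0 : 0 <= v. Proof. exact: mulr_ge0. Qed.
Let v_le : v <= 1 / 4. Proof. by have := sqr_ge0 (r - 1 / 2); nra. Qed.

Lemma bern_mean_affine h s t u y :
  bern_mean (fun z => h (t * z + u)) s y =
  bern_mean h [seq t * x | x <- s] (t * y + u).
Proof.
elim: s y => [//|x s IH] y /=; rewrite !IH.
by congr (_ * bern_mean _ _ _ + _); rewrite mulrDr addrAC.
Qed.

Lemma bern_mean_scale k h s y :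
  bern_mean (fun z => k * h z) s y = k * bern_mean h s y.
Proof. by elim: s y => [//|x s IH] y /=; rewrite !IH mulrDr !(mulrCA k). Qed.

Lemma bern_mean_id s y : bern_mean id s y = y + r * \sum_(x <- s) x.
Proof.
elim: s y => [|x s IH] y /=; first by rewrite big_nil mulr0 addr0.
by rewrite !IH big_cons; ring.
Qed.

Lemma bern_mean_sqr s u y : bern_mean (fun z => (z - u) ^+ 2) s y =
  v * \sum_(x <- s) x ^+ 2 + (y + r * \sum_(x <- s) x - u) ^+ 2.
Proof.
elim: s y => [|x s IH] y /=; first by rewrite !big_nil !mulr0 addr0 add0r.
by rewrite !IH !big_cons; ring.
Qed.

(** The means of cos and sin are the real and imaginary parts of E exp(i(y + Y)); shifting y by x
    multiplies this number by exp(ix). *)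
Lemma bern_mean_cosD s x y :
  bern_mean cos s (y + x) = cos x * bern_mean cos s y - sin x * bern_mean sin s y.
Proof.
elim: s y => [|z s IH] y /=; first by rewrite cosD mulrC [sin y * _]mulrC.
by rewrite !(addrAC y x z) !IH; ring.
Qed.

Lemma bern_mean_sinD s x y :
  bern_mean sin s (y + x) = cos x * bern_mean sin s y + sin x * bern_mean cos s y.
Proof.
elim: s y => [|z s IH] y /=; first by rewrite sinD mulrC [cos y * _]mulrC.
by rewrite !(addrAC y x z) !IH; ring.
Qed.

(** The squared modulus of E exp(i(y + Y)) is the product of the |1 - r + r exp(ix)|^2, whatever y
    is. *)
Lemma bern_mean_cos2Dsin2 s y :
  bern_mean cos s y ^+ 2 + bern_mean sin s y ^+ 2 =
  \prod_(x <- s) (1 - 2 * v * (1 - cos x)).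
Proof.
elim: s => [|x s IH] /=; first by rewrite big_nil cos2Dsin2.
rewrite big_cons -IH bern_mean_cosD bern_mean_sinD.
by have := sin2cos2 x; move: (sin x) (cos x) => S C SC; ring: SC.
Qed.

(** The real part is at most the modulus, and in the squared modulus each factor 1 - u is at most
    exp(-u). The factors are nonnegative because r(1-r) <= 1/4, so these inequalities multiply. *)
Lemma bern_mean_cos_le s y :
  `|bern_mean cos s y| <= expR (- (v * \sum_(x <- s) (1 - cos x))).
Proof.
rewrite -(ler_pXn2r (_ : (0 < 2)%N)) ?nnegrE ?expR_ge0 //.
rewrite real_normK ?num_real // -expRM_natl.
apply: (@le_trans _ _ (\prod_(x <- s) (1 - 2 * v * (1 - cos x)))).
  by rewrite -(bern_mean_cos2Dsin2 s y) lerDl sqr_ge0.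
have -> : 2 * - (v * \sum_(x <- s) (1 - cos x)) =
    \sum_(x <- s) - (2 * v * (1 - cos x)).
  by rewrite sumrN -mulr_sumr; ring.
rewrite expR_sum.
elim: s => [|x s IH]; first by rewrite !big_nil.
have cx0 : 0 <= 1 - cos x <= 2 by have := cos_le1 x; have := cos_geN1 x; lra.
have vx : 0 <= 1 - 2 * v * (1 - cos x) by have := v_le; have := v_ge0; nra.
have vs : 0 <= \prod_(x <- s) (1 - 2 * v * (1 - cos x)).
  by rewrite -(bern_mean_cos2Dsin2 s y) addr_ge0 ?sqr_ge0.
by rewrite !big_cons ler_pM // expR_ge1Dx.
Qed.

(** A centred Bernoulli step takes the values (1-r)x and -rx with probabilities r and 1-r; its mean
    is 0 and its variance r(1-r)x^2, as for the Gaussian factor. *)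
Lemma bern_factor_dist x y :
  `|r * cos (y + (1 - r) * x) + (1 - r) * cos (y - r * x)
    - cos y * expR (- (v * x ^+ 2 / 2))| <= 3 * `|x| ^+ 3.
Proof.
have v01 : 0 <= v <= 1 by have := v_ge0; have := v_le; lra.
have := expRN_taylor1 x v01; set E := expR _ => hE.
have X0 : 0 <= `|x| ^+ 3 by rewrite exprn_ge0.
have small (k : R) : 0 <= k <= 1 -> `|k * x| ^+ 3 <= `|x| ^+ 3.
  move=> /andP[k0 k1]; rewrite lerXn2r ?nnegrE // normrM.
  by rewrite (ger0_norm k0) ler_piMl.
have r01' : 0 <= r <= 1 by have := r_ge0; have := r1_ge0; lra.
have r01'' : 0 <= 1 - r <= 1 by have := r_ge0; have := r1_ge0; lra.
have c1 := le_trans (cos_taylor2 ((1 - r) * x)) (small _ r01'').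
have c2 := le_trans (cos_taylor2 (r * x)) (small _ r01').
have s1 : `|sin ((1 - r) * x) - (1 - r) * x| <= `|x| ^+ 3.
  by apply: le_trans (sin_sub_le _) _; have := small _ r01''; lra.
have s2 : `|sin (r * x) - r * x| <= `|x| ^+ 3.
  by apply: le_trans (sin_sub_le _) _; have := small _ r01'; lra.
rewrite cosD cosB.
have hc := cos_max y; have hs := sin_max y.
set C1 := cos ((1 - r) * x) in c1 *; set C2 := cos (r * x) in c2 *.
set S1 := sin ((1 - r) * x) in s1 *; set S2 := sin (r * x) in s2 *.
(* The Taylor terms of order at most 2 cancel. The remaining errors, of the cosines, the exponential
   and the sines, are each at most |x|^3. *)
have -> : r * (cos y * C1 - sin y * S1) + (1 - r) * (cos y * C2 + sin y * S2)
    - cos y * E =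
    cos y * (r * (C1 - 1 + ((1 - r) * x) ^+ 2 / 2) +
             (1 - r) * (C2 - 1 + (r * x) ^+ 2 / 2)) -
    cos y * (E - 1 + v * x ^+ 2 / 2) +
    sin y * ((1 - r) * (S2 - r * x) - r * (S1 - (1 - r) * x)).
  by field.
have mix (a b : R) : `|a| <= `|x| ^+ 3 -> `|b| <= `|x| ^+ 3 ->
    `|r * a + (1 - r) * b| <= `|x| ^+ 3.
  rewrite !ler_norml => /andP[a1 a2] /andP[b1 b2].
  by have ? := r_ge0; have ? := r1_ge0; apply/andP; split; nra.
have unit (a b : R) : `|a| <= 1 -> `|b| <= `|x| ^+ 3 -> `|a * b| <= `|x| ^+ 3.
  by move=> a1 b1; rewrite normrM (le_trans _ b1) // ler_piMl.
have k1 := unit _ _ hc (mix _ _ c1 c2).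
have k2 := unit _ _ hc hE.
have k3 : `|sin y * ((1 - r) * (S2 - r * x) - r * (S1 - (1 - r) * x))| <= `|x| ^+ 3.
  by apply: unit => //; rewrite addrC -mulrN; apply: mix; rewrite // normrN.
rewrite (le_trans (ler_normD _ _)) //.
have := ler_normB (cos y * (r * (C1 - 1 + ((1 - r) * x) ^+ 2 / 2) +
   (1 - r) * (C2 - 1 + (r * x) ^+ 2 / 2))) (cos y * (E - 1 + v * x ^+ 2 / 2)).
by lra.
Qed.

(** Summands are replaced by Gaussian factors one at a time; the errors merely add up because r and
    1-r sum to 1 and the Gaussian factor is at most 1. *)
Lemma bern_mean_cos_gauss s y :
  `|bern_mean cos s y
    - cos (y + r * \sum_(x <- s) x) * expR (- (v * (\sum_(x <- s) x ^+ 2) / 2))|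
  <= \sum_(x <- s) 3 * `|x| ^+ 3.
Proof.
elim: s y => [|x s IH] y /=.
  by rewrite !big_nil !(mulr0, mul0r, oppr0, expR0, addr0, mulr1, subrr, normr0).
rewrite !big_cons; set m := r * \sum_(x <- s) x in IH *.
set q := \sum_(x <- s) x ^+ 2 in IH *.
rewrite (_ : - (v * (x ^+ 2 + q) / 2) = - (v * x ^+ 2 / 2) + - (v * q / 2));
  last by ring.
rewrite expRD; move: (IH (y + x)) (IH y).
set g := expR (- (v * q / 2)) => IH1 IH2.
have g1 : g <= 1 by rewrite /g expR_le1 oppr_le0 divr_ge0 // mulr_ge0 ?sumr_ge0
  // => i _; rewrite sqr_ge0.
set z := y + r * (x + \sum_(x <- s) x).
have := bern_factor_dist x z.
have -> : z + (1 - r) * x = y + x + m by rewrite /z /m; ring.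
have -> : z - r * x = y + m by rewrite /z /m; ring.
set gx := expR (- (v * x ^+ 2 / 2)); set D := (X in `|X| <= _) => hD.
set a := bern_mean cos s (y + x) in IH1 *; set b := bern_mean cos s y in IH2 *.
have -> : r * a + (1 - r) * b - cos z * (gx * g) =
  r * (a - cos (y + x + m) * g) + (1 - r) * (b - cos (y + m) * g) + g * D.
  by rewrite /D; ring.
have gD : `|g * D| <= 3 * `|x| ^+ 3.
  rewrite normrM ger0_norm ?expR_ge0 // (le_trans _ hD) // ler_piMl //.
rewrite (le_trans (ler_normD _ _)) // addrC lerD //.
move: IH1 IH2; rewrite !ler_norml => /andP[a1 a2] /andP[b1 b2].
by have ? := r_ge0; have ? := r1_ge0; apply/andP; split; nra.
Qed.

End bern_mean.

(** * The cosine transform of a Gaussian *)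

Section integral0.
Context {R : realType}.
Local Notation mu := (@lebesgue_measure R).
Implicit Types (f F : R -> R) (b x : R).

Definition integral0 f b : R := \int[mu]_(t in `[0, b]) f t.

Lemma continuous_itv_integrable f a b :
  continuous f -> mu.-integrable `[a, b] (EFin \o f).
Proof.
move=> cf; apply: continuous_compact_integrable; first exact: segment_compact.
exact: continuous_subspaceT.
Qed.

Lemma integral00 f : integral0 f 0 = 0.
Proof. by rewrite /integral0 set_itv1 Rintegral_set1. Qed.

Lemma within_continuous_integral0 f b :
  continuous f -> 0 <= b -> {within `[0, b], continuous (integral0 f)}.
Proof.
move=> cf b0; apply: parameterized_integral_continuous => //.
exact: continuous_itv_integrable.
Qed.

Lemma is_derive_integral0 f x :
  continuous f -> 0 < x -> is_derive x 1 (integral0 f) (f x).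
Proof.
move=> cf x0.
have [||||d e] := @continuous_FTC1_closed R f 0 x (x + 1) _ _ _ _.
- by rewrite ltrDl.
- exact: continuous_itv_integrable.
- exact: x0.
- exact: cf.
by apply: DeriveDef; [exact: d | rewrite -derive1E; exact: e].
Qed.

(** The difference of the two primitives has derivative 0 on the open interval, so the mean value
    inequality applies with bound 0. *)
Lemma integral0_primitive f F b :
  continuous f -> (forall x : R, 0 <= x -> is_derive x 1 F (f x)) -> 0 <= b ->
  integral0 f b = F b - F 0.
Proof.
move=> cf dF b0.
have h : `|(integral0 f b - F b) - (integral0 f 0 - F 0)| <= (0 : R) - 0.
  apply: (@ler_dist_derive R (fun x => integral0 f x - F x) (cst 0)
    (fun x => f x - f x) (cst 0) 0 b b0).
  - move=> x; apply: cvgB; first exact: within_continuous_integral0.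
    apply: derivable_within_continuous => y; rewrite in_itv /= => /andP[y0 _].
    by have ? := dF y y0; exact: ex_derive.
  - by move=> x; exact: cvg_cst.
  - move=> x /andP[x0 _].
    have ? := is_derive_integral0 cf x0; have ? := dF x (ltW x0).
    exact: is_deriveB.
  - by move=> x _ /=; rewrite subrr normr0.
by move: h; rewrite subrr normr_le0 integral00 => /eqP; lra.
Qed.

End integral0.

(** The sign of [k] is left free: -1/k will give the growing integrating factor exp(y^2/(2k)). *)
Lemma is_derive_expR_sqr (R : realType) (k t : R) : k != 0 ->
  is_derive t 1 (fun s : R => expR (- (k * s ^+ 2 / 2)))
    (- (k * t) * expR (- (k * t ^+ 2 / 2))).
Proof.
move=> k0.
have d1 : is_derive t 1 (fun s : R => - (k * s ^+ 2 / 2)) (- (k * t)).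
  have -> : (fun s : R => - (k * s ^+ 2 / 2)) = (fun s => s ^+ 2 / - (2 / k)).
    by apply/funext => s; field.
  by apply: is_derive_eq (is_derive_expn_div 1 (- (2 / k)) t) _; field.
apply: is_derive_eq (is_derive1_comp (is_derive_expR _) d1) _.
by rewrite mulrC.
Qed.

Lemma is_derive_mulr_comp (R : realType) (f : R -> R) (f' t x : R) :
  is_derive (t * x) 1 f f' -> is_derive t 1 (fun s : R => f (s * x)) (x * f').
Proof.
move=> df.
have d1 : is_derive t 1 (fun s : R => s * x) x.
  by have := is_derive_expn_div 0 x^-1 t; rewrite invrK expr0 !mul1r.
by rewrite mulrC; exact: (@is_derive1_comp _ f (fun s => s * x) t f' x df d1).
Qed.

Lemma continuous_is_derive (R : realType) (f f' : R -> R) :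
  (forall t : R, is_derive t 1 f (f' t)) -> continuous f.
Proof.
move=> df t; apply: differentiable_continuous; apply/derivable1_diffP.
by have ? := df t; exact: ex_derive.
Qed.


Section gaussian_cosine_integral.
Context {R : realType}.
Variable k : R.
Hypothesis k_gt0 : 0 < k.
Implicit Types (t x b : R).
Local Notation mu := (@lebesgue_measure R).

Definition gauss_cos x t : R := expR (- (k * t ^+ 2 / 2)) * cos (t * x).

Local Notation E t := (expR (- (k * t ^+ 2 / 2))).

Let is_derive_gauss t := is_derive_expR_sqr t (lt0r_neq0 k_gt0).

Lemma is_derive_gauss_cos x t :
  is_derive t 1 (gauss_cos x) (- (k * t) * gauss_cos x t - x * (E t * sin (t * x))).
Proof.
have d1 := is_derive_mulr_comp (is_derive_cos (t * x)).
apply: is_derive_eq (is_deriveM (is_derive_gauss t) d1) _.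
by rewrite /gauss_cos /GRing.scale /=; ring.
Qed.

Lemma is_derive_gauss_sin x t :
  is_derive t 1 (fun s : R => E s * sin (s * x))
    (k * - (t * (E t * sin (t * x))) + x * gauss_cos x t).
Proof.
have d1 := is_derive_mulr_comp (is_derive_sin (t * x)).
apply: is_derive_eq (is_deriveM (is_derive_gauss t) d1) _.
by rewrite /gauss_cos /GRing.scale /=; ring.
Qed.

Lemma continuous_gauss_cos x : continuous (gauss_cos x).
Proof. exact: continuous_is_derive (is_derive_gauss_cos x). Qed.

Let gauss_xsin x t : R := - (t * (E t * sin (t * x))).

Lemma continuous_gauss_xsin x : continuous (gauss_xsin x).
Proof.
move=> t; apply: cvgN; apply: cvgM; first exact: cvg_id.
exact: (continuous_is_derive (is_derive_gauss_sin x)).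
Qed.

Lemma is_derive_gauss_cos_param t x :
  is_derive x 1 (fun y => gauss_cos y t) (gauss_xsin x t).
Proof.
have d1 : is_derive x 1 (fun y => cos (t * y)) (t * - sin (t * x)).
  under eq_fun do rewrite mulrC.
  by apply: is_derive_mulr_comp; rewrite (mulrC t x); exact: is_derive_cos.
apply: is_derive_eq (is_deriveZ (E t) d1) _.
by rewrite /gauss_xsin /GRing.scale /=; ring.
Qed.

Lemma is_derive_integral0_gauss_cos b x :
  is_derive x 1 (fun y => integral0 (gauss_cos y) b) (integral0 (gauss_xsin x) b).
Proof.
have xI : `]x - 1, x + 1[%classic x by rewrite /= in_itv /= ltrBlDr !ltrDl ltr01.
have pE y t : partial1of2 gauss_cos y t = gauss_xsin y t.
  by rewrite partial1of2E; have ? := is_derive_gauss_cos_param t y; exact: derive_val.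
have intf y : `]x - 1, x + 1[%classic y ->
    mu.-integrable `[0, b] (EFin \o gauss_cos y).
  by move=> _; exact/continuous_itv_integrable/continuous_gauss_cos.
have der y t : `]x - 1, x + 1[%classic y -> `[0, b]%classic t ->
    derivable (gauss_cos ^~ t) y 1.
  by move=> _ _; have ? := is_derive_gauss_cos_param t y; exact: ex_derive.
(* Domination on [0, b]: the derivative in the parameter is at most t <= b in absolute value. *)
have intG : mu.-integrable `[0, b] (EFin \o cst `|b|).
  by apply: continuous_itv_integrable => ?; exact: cvg_cst.
have ub y t : `]x - 1, x + 1[%classic y -> `[0, b]%classic t ->
    `|partial1of2 gauss_cos y t| <= cst `|b| t.
  move=> _; rewrite /= in_itv /= => /andP[t0 tb]; rewrite pE /gauss_xsin.
  rewrite normrN normrM ger0_norm // (le_trans _ (ler_norm b)) // (le_trans _ tb) //.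
  rewrite ler_piMr // normrM mulr_ile1 ?normr_ge0 ?sin_max //.
  rewrite ger0_norm ?expR_ge0 // expR_le1 oppr_le0 divr_ge0 //.
  by rewrite mulr_ge0 ?sqr_ge0 // ltW.
have G0 (t : R) : 0 <= cst `|b| t by exact: normr_ge0.
apply: DeriveDef.
  exact: (@derivable_under_integral R _ _ mu gauss_cos `[0, b]%classic
    (measurable_itv _) x _ _ xI intf der _ G0 intG ub).
rewrite -derive1E (@differentiation_under_integral R _ _ mu gauss_cos `[0, b]%classic
    (measurable_itv _) x _ _ xI intf der _ G0 intG ub).
by apply: eq_Rintegral => t _; exact: pE.
Qed.

(** Obtained by integrating the derivative of exp(-kt^2/2) sin(tx). For the truncated transform I(x)
    it is the differential equation k I' + x I = boundary term. *)
Lemma integral0_gauss_xsin b x : 0 <= b ->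
  k * integral0 (gauss_xsin x) b + x * integral0 (gauss_cos x) b =
  E b * sin (b * x).
Proof.
move=> b0.
have i1 := continuous_itv_integrable 0 b (@continuous_gauss_xsin x).
have i2 := continuous_itv_integrable 0 b (@continuous_gauss_cos x).
have c3 : continuous (fun t => k * gauss_xsin x t + x * gauss_cos x t).
  move=> t; apply: cvgD; apply: cvgM; try exact: cvg_cst.
    exact: continuous_gauss_xsin.
  exact: continuous_gauss_cos.
have := integral0_primitive c3 (fun t _ => is_derive_gauss_sin x t) b0.
rewrite mul0r sin0 mulr0 subr0 => <-.
rewrite /integral0 RintegralD //; last 2 first.
- by apply: continuous_itv_integrable => t; apply: cvgM;
    [exact: cvg_cst|exact: continuous_gauss_xsin].
- by apply: continuous_itv_integrable => t; apply: cvgM;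
    [exact: cvg_cst|exact: continuous_gauss_cos].
by rewrite !RintegralZl.
Qed.

(** The integrating factor exp(x^2/(2k)) leaves only the boundary term in the derivative of the
    product; that term vanishes as b grows. *)
Lemma integral0_gauss_cos_dist b x : 0 <= b -> 0 <= x ->
  `|expR (x ^+ 2 / (2 * k)) * integral0 (gauss_cos x) b - integral0 (gauss_cos 0) b|
  <= expR (x ^+ 2 / (2 * k)) * E b / k * x.
Proof.
move=> b0 x0.
have k0 := lt0r_neq0 k_gt0.
(* The two minus signs make [e] an instance of [is_derive_expR_sqr] with -1/k. *)
pose e (y : R) := expR (- (- k^-1 * y ^+ 2 / 2)).
have eE y : e y = expR (y ^+ 2 / (2 * k)) by congr expR; field.
have k1 : - k^-1 != 0 by rewrite oppr_eq0 invr_eq0.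
have de y := is_derive_expR_sqr y k1.
have dh (y : R) : is_derive y 1 (fun y : R => e y * integral0 (gauss_cos y) b)
    (e y * (E b * sin (b * y)) / k).
  apply: is_derive_eq (is_deriveM (de y) (is_derive_integral0_gauss_cos b y)) _.
  by rewrite -(integral0_gauss_xsin y b0) /GRing.scale /= -/(e y); field.
have dg (y : R) : is_derive y 1 (fun y : R => y * (e x * E b / k)) (e x * E b / k).
  have := is_derive_expn_div 0 (e x * E b / k)^-1 y.
  by rewrite invrK expr0 !mul1r.
have := @ler_dist_derive R (fun y => e y * integral0 (gauss_cos y) b)
  (fun y => y * (e x * E b / k)) (fun y => e y * (E b * sin (b * y)) / k)
  (fun=> e x * E b / k) 0 x x0.
rewrite mul0r subr0 /= !eE expr0n /= mul0r expR0 mul1r [x * _]mulrC; apply.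
- by apply: derivable_within_continuous => y _; have ? := dh y; exact: ex_derive.
- by apply: derivable_within_continuous => y _; have ? := dg y; exact: ex_derive.
- by move=> y _; rewrite -eE; exact: dg.
move=> y /andP[y0 yx]; rewrite normrM (gtr0_norm (_ : 0 < k^-1)) ?invr_gt0 //.
rewrite ler_pM2r ?invr_gt0 // normrM (gtr0_norm (expR_gt0 _)).
rewrite ler_pM ?expR_ge0 ?normr_ge0 //.
  rewrite -/(e y) eE ler_expR ler_pM2r ?invr_gt0 ?mulr_gt0 //.
  by rewrite lerXn2r ?nnegrE //; exact: ltW.
rewrite normrM (gtr0_norm (expR_gt0 _)) ler_piMr ?expR_ge0 //; exact: sin_max.
Qed.

Lemma cvg_gauss : E b @[b --> +oo] --> (0 : R).
Proof.
have h : k * (b ^+ 2 / 2) @[b --> +oo] --> +oo.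
  under eq_fun do rewrite mulrCA.
  by apply: (gt0_cvgMly _ (@cvgr_expr2 R)); rewrite mulr_gt0 ?invr_gt0.
under eq_fun do rewrite -mulrA.
exact: (cvg_comp (fun b : R => k * (b ^+ 2 / 2)) (fun x : R => expR (- x)) h
  (@cvgr_expR R)).
Qed.

Lemma cvg_integral0_gauss :
  integral0 (@gauss_fun R) b @[b --> +oo] --> Num.sqrt pi / 2.
Proof.
have E4 : Num.sqrt (pi / 4) = Num.sqrt pi / 2 :> R.
  rewrite sqrtrM ?pi_ge0 // sqrtrV // (_ : 4 = 2 ^+ 2); last by rewrite expr2 -natrM.
  by rewrite sqrtr_sqr ger0_norm.
have : Num.sqrt (integral0 (@gauss_fun R) b ^+ 2) @[b --> +oo] --> Num.sqrt (pi / 4).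
  have := @gauss_integral_proof.cvg_integral0_gauss_sqr R.
  by apply: continuous_cvg; exact: sqrt_continuous.
rewrite E4; apply: cvg_trans; apply: near_eq_cvg; near=> b.
by rewrite sqrtr_sqr ger0_norm // gauss_integral_proof.integral0_gauss_ge0.
Unshelve. all: end_near. Qed.

(** A linear change of variable, carried out on primitives. *)
Lemma integral0_gauss_cos0 b : 0 <= b ->
  integral0 (gauss_cos 0) b =
  integral0 gauss_fun (Num.sqrt (k / 2) * b) / Num.sqrt (k / 2).
Proof.
move=> b0; set q := Num.sqrt (k / 2).
have q0 : 0 < q by rewrite sqrtr_gt0 divr_gt0.
(* Starting at -1 makes 0 an interior point, so that [F] has a two-sided derivative there. *)
pose F y : R := \int[mu]_(t in `[-1, y]) gauss_fun t.
have dF (y : R) : 0 <= y -> is_derive y 1 F (gauss_fun y).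
  move=> y0.
  have [||||d e] := @continuous_FTC1_closed R gauss_fun (-1) y (y + 1) _ _ _ _.
  - by rewrite ltrDl.
  - exact/continuous_itv_integrable/continuous_gauss_fun.
  - by rewrite (lt_le_trans _ y0).
  - exact: continuous_gauss_fun.
  by apply: DeriveDef; [exact: d | rewrite -derive1E; exact: e].
have dFq (y : R) : 0 <= y ->
    is_derive y 1 (fun s : R => q^-1 * F (s * q)) (gauss_cos 0 y).
  move=> y0; have yq : 0 <= y * q by rewrite mulr_ge0 // ltW.
  apply: is_derive_eq (is_deriveZ q^-1 (is_derive_mulr_comp (dF _ yq))) _.
  rewrite /GRing.scale /= mulKf ?gt_eqF // /gauss_cos mulr0 cos0 mulr1.
  rewrite /gauss_fun exprMn sqr_sqrtr; last by rewrite ltW // divr_gt0.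
  by congr expR; field.
rewrite (integral0_primitive (@continuous_gauss_cos 0) dFq b0).
have qb : 0 <= q * b by rewrite mulr_ge0 // ltW.
rewrite (integral0_primitive (@continuous_gauss_fun R) dF qb).
by rewrite mul0r (mulrC q b); ring.
Qed.

Lemma cvg_integral0_gauss_cos x : 0 <= x ->
  integral0 (gauss_cos x) b @[b --> +oo] -->
  Num.sqrt (pi / (2 * k)) * expR (- (x ^+ 2 / (2 * k))).
Proof.
move=> x0; set e := expR (x ^+ 2 / (2 * k)).
have e0 : 0 < e by exact: expR_gt0.
rewrite expRN -/e.
have q0 : 0 < Num.sqrt (k / 2) by rewrite sqrtr_gt0 divr_gt0.
have h0 : integral0 (gauss_cos 0) b @[b --> +oo] --> Num.sqrt (pi / (2 * k)).
  have -> : Num.sqrt (pi / (2 * k)) = Num.sqrt pi / 2 / Num.sqrt (k / 2) :> R.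
    rewrite -[RHS]ger0_norm; last by rewrite !divr_ge0 // ltW.
    rewrite -sqrtr_sqr; congr Num.sqrt.
    rewrite !exprMn !exprVn !sqr_sqrtr ?pi_ge0 ?divr_ge0 ?ltW //.
    by field; rewrite gt_eqF.
  have h : integral0 gauss_fun (Num.sqrt (k / 2) * b) / Num.sqrt (k / 2) @[b --> +oo]
      --> Num.sqrt pi / 2 / Num.sqrt (k / 2).
    apply: cvgM; last exact: cvg_cst.
    apply: (cvg_comp (fun b => Num.sqrt (k / 2) * b) (integral0 gauss_fun)).
      by apply: (gt0_cvgMry q0); exact: cvg_id.
    exact: cvg_integral0_gauss.
  apply: cvg_trans h; apply: near_eq_cvg; near=> b.
  by rewrite integral0_gauss_cos0.
have h1 : integral0 (gauss_cos 0) b / e @[b --> +oo] --> Num.sqrt (pi / (2 * k)) / e.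
  by apply: cvgM; [exact: h0 | exact: cvg_cst].
have h2 : E b * (k^-1 * x) @[b --> +oo] --> (0 : R).
  rewrite -[X in _ --> X](mul0r (k^-1 * x)).
  by apply: cvgM; [exact: cvg_gauss | exact: cvg_cst].
have h3 : integral0 (gauss_cos x) b - integral0 (gauss_cos 0) b / e @[b --> +oo]
    --> (0 : R).
  apply/norm_cvg0P.
  apply: (@squeeze_cvgr _ _ _ _ (cst 0) (fun b => E b * (k^-1 * x))) => //.
    near=> b; have b0 : 0 <= b by [].
    rewrite /= normr_ge0 /= -(ler_pM2l e0) -{1}(gtr0_norm e0) -normrM mulrBr.
    rewrite [e * (_ / e)]mulrC divfK ?gt_eqF //.
    by rewrite (le_trans (integral0_gauss_cos_dist b0 x0)) // -/e !mulrA.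
  exact: cvg_cst.
rewrite -[X in _ --> X]add0r.
have -> : integral0 (gauss_cos x) = (fun b => integral0 (gauss_cos x) b
    - integral0 (gauss_cos 0) b / e + integral0 (gauss_cos 0) b / e).
  by apply/funext => b; rewrite subrK.
exact: cvgD.
Unshelve. all: end_near. Qed.

End gaussian_cosine_integral.

(** * The law of the sum *)

Lemma sum_tuple_recl (R : nmodType) (n : nat) (T : finType)
    (f : n.+1.-tuple T -> R) :
  \sum_b f b = \sum_e \sum_(b : n.-tuple T) f [tuple of e :: b].
Proof.
rewrite pair_big /=.
rewrite (reindex (fun p : T * n.-tuple T => [tuple of p.1 :: p.2])) //=.
exists (fun b => (thead b, [tuple of behead b])) => /= [[e b] _|b _].
  by congr (_, _); apply/val_inj.
by rewrite -tuple_eta.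
Qed.

Definition bern_weight (R : pzRingType) (r : R) (e : bool) : R :=
  if e then r else 1 - r.

(** The recursion expanded over all outcomes with their probabilities; this links [bern_mean] with
    events of the probability space. *)
Lemma bern_mean_tuple (R : realType) (r : R) (n : nat) (c : 'I_n -> R)
    (h : R -> R) (y : R) :
  \sum_(b : n.-tuple bool)
    (\prod_(i < n) bern_weight r (tnth b i))
      * h (y + \sum_(i < n) c i * (tnth b i)%:R) =
  bern_mean r h [seq c i | i <- enum 'I_n] y.
Proof.
elim: n c y => [|n IH] c y.
  rewrite enum_ord0 /= (eq_bigr (fun=> h y)); last first.
    by move=> b _; rewrite !big_ord0 addr0 mul1r.
  by rewrite sumr_const card_tuple expn0 mulr1n.
rewrite enum_ordSl /= -map_comp sum_tuple_recl big_bool /=.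
congr (_ + _); rewrite -(IH (fun i => c (lift ord0 i))) mulr_sumr;
  apply: eq_bigr => b _; rewrite !big_ord_recl !tnth0 /= -mulrA;
  congr (_ * (_ * h _)).
- by apply: eq_bigr => i _; rewrite tnthS.
- rewrite mulr1 addrA; congr (_ + _).
  by apply: eq_bigr => i _; rewrite tnthS.
- by apply: eq_bigr => i _; rewrite tnthS.
- rewrite mulr0 add0r; congr (_ + _).
  by apply: eq_bigr => i _; rewrite tnthS.
Qed.

Lemma bern_mean_cst (R : realType) (r k : R) (s : seq R) (y : R) :
  bern_mean r (cst k) s y = k.
Proof. by elim: s y => [//|x s IH] y /=; rewrite !IH /=; ring. Qed.

Section law_of_sum.
Context {d : measure_display} {T : measurableType d} {R : realType}.
Variable P : probability T R.
Variables (r : R) (n : nat) (c : 'I_n -> R) (X : 'I_n -> {RV P >-> R}).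
Hypothesis c_neq0 : forall i, c i != 0.
Hypothesis lawX : forall i, two_point_law r (c i) (X i).
Hypothesis indepX : mutually_independent X.

Let S w := \sum_(i < n) X i w.

Let event (b : n.-tuple bool) : set T :=
  \bigcap_(i in [set` [set: 'I_n]%SET]) X i @^-1` [set c i * (tnth b i)%:R].

Let measurable_event b : measurable (event b).
Proof.
apply: fin_bigcap_measurable; first exact: finite_finset.
move=> i _; rewrite -[_ @^-1` _]setTI; apply: measurable_funP => //.
Qed.

Let prob_event b : P (event b) = (\prod_(i < n) bern_weight r (tnth b i))%:E.
Proof.
rewrite (indepX [set: 'I_n]%SET (fun i => measurable_set1 (c i * (tnth b i)%:R))).
rewrite (eq_bigr (fun i => (bern_weight r (tnth b i))%:E)); last first.
  move=> i _; rewrite lawX // !diracE.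
  case: (tnth b i); rewrite ?mulr1 ?mulr0 /=.
    rewrite mem_set // memNset; last by move/esym/eqP; exact/negP.
    by rewrite mule1 mule0 adde0.
  rewrite memNset; last by move/eqP; exact/negP.
  by rewrite mem_set // mule1 mule0 add0e.
by rewrite prodEFin; congr EFin; apply: eq_bigl => i; rewrite finset.in_setT.
Qed.

Let trivIset_event (s : seq (n.-tuple bool)) : trivIset [set` s] event.
Proof.
move=> b b' _ _ [w [wb wb']]; apply: eq_from_tnth => i.
have h1 : X i w = c i * (tnth b i)%:R by apply: (wb i); rewrite /= finset.in_setT.
have h2 : X i w = c i * (tnth b' i)%:R by apply: (wb' i); rewrite /= finset.in_setT.
have /(mulfI (c_neq0 i)) /eqP := etrans (esym h1) h2.
by rewrite eqr_nat; case: (tnth b i) (tnth b' i) => [] [].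
Qed.

Let S_event b w : event b w -> S w = \sum_(i < n) c i * (tnth b i)%:R.
Proof.
by move=> wb; apply: eq_bigr => i _; apply: (wb i); rewrite /= finset.in_setT.
Qed.

(** The events prescribing all the X_i are disjoint because c_i is nonzero, [S] is constant on each,
    and their union [U] has probability 1. *)
Lemma integral_bern_sum (h : R -> R) : measurable_fun setT h ->
  (\int[P]_w (h (S w))%:E =
    (bern_mean r h [seq c i | i <- enum 'I_n] 0)%:E)%E.
Proof.
move=> mh; pose U := \big[setU/set0]_(b <- index_enum (n.-tuple bool)) event b.
have mU : measurable U by exact: bigsetU_measurable.
have mS : measurable_fun setT S by exact: measurable_sum.
have split (f : R -> R) : measurable_fun setT f ->
    (\int[P]_(w in U) (f (S w))%:E =
      (bern_mean r f [seq c i | i <- enum 'I_n] 0)%:E)%E.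
  move=> mf; rewrite integral_bigsetU_EFin //; last 2 first.
  - exact: index_enum_uniq.
  - apply/measurable_EFinP; apply: measurable_funTS; exact: measurableT_comp.
  rewrite -bern_mean_tuple -sumEFin; apply: eq_bigr => b _.
  rewrite (eq_integral (cst (f (\sum_(i < n) c i * (tnth b i)%:R))%:E)); last first.
    by move=> w; rewrite inE => /S_event ->.
  apply: (@etrans _ _ ((f (\sum_(i < n) c i * (tnth b i)%:R))%:E * P (event b))%E).
    exact: integral_cst.
  by rewrite prob_event add0r -EFinM mulrC.
(* The same computation, applied to the constant 1, gives the total probability. *)
have PU : P U = 1%E.
  have := split (cst 1) (measurable_cst _).
  rewrite bern_mean_cst => <-.
  by rewrite (eq_integral (cst 1%E)) // integral_cst // mul1e.
have PUC : P (~` U) = 0%E by rewrite probability_setC // PU subee.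
rewrite -(setUv U) integral_setU //; last 3 first.
- exact: measurableC.
- by apply/measurable_EFinP; apply: measurable_funTS; exact: measurableT_comp.
- by rewrite disj_set2E setICr.
rewrite split // (null_set_integral _ _ PUC) ?adde0 //; last first.
  by apply/measurable_EFinP; apply: measurable_funTS; exact: measurableT_comp.
exact: measurableC.
Qed.

End law_of_sum.

Section moments_of_sum.
Context {d : measure_display} {T : measurableType d} {R : realType}.
Variable P : probability T R.
Variables (r : R) (n : nat) (c : 'I_n -> R) (X : 'I_n -> {RV P >-> R}).
Hypothesis c_neq0 : forall i, c i != 0.
Hypothesis lawX : forall i, two_point_law r (c i) (X i).
Hypothesis indepX : mutually_independent X.

Let S w := \sum_(i < n) X i w.
Let s := [seq c i | i <- enum 'I_n].

Let integral_S (h : R -> R) : measurable_fun setT h ->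
  (\int[P]_w (h (S w))%:E = (bern_mean r h s 0)%:E)%E.
Proof. exact: integral_bern_sum. Qed.

Lemma expectation_bern_sum : ('E_P[S] = (r * \sum_(x <- s) x)%:E)%E.
Proof.
rewrite unlock (integral_S (@measurable_id _ _ _)).
by rewrite bern_mean_id add0r.
Qed.

Lemma variance_bern_sum :
  ('V_P[S] = (r * (1 - r) * \sum_(x <- s) x ^+ 2)%:E)%E.
Proof.
rewrite /variance unlock expectation_bern_sum unlock /=.
have := @integral_S (fun z => (z - r * \sum_(x <- s) x) ^+ 2).
rewrite bern_mean_sqr add0r subrr expr0n addr0 => <- //.
by apply: measurable_funX; apply: measurable_funB.
Qed.

Lemma probability_bern_sum (a : R) :
  P (S @^-1` [set a]) = (bern_mean r \1_[set a] s 0)%:E.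
Proof.
have mS : measurable_fun setT S by exact: measurable_sum.
have ma : measurable (S @^-1` [set a]).
  by rewrite -[_ @^-1` _]setTI; exact: mS.
rewrite -(@integral_S \1_[set a]); last exact: measurable_indic.
rewrite -[LHS](_ : (\int[P]_w (\1_(S @^-1` [set a]) w)%:E)%E = _) //.
by rewrite integral_indic // setIT.
Qed.

End moments_of_sum.

(** * Fourier inversion *)

Lemma is_derive_bern_mean (R : realType) (r : R) (h : R -> R -> R) (h' : R -> R)
    (s : seq R) (t y : R) :
  (forall z, is_derive t 1 (h ^~ z) (h' z)) ->
  is_derive t 1 (fun u : R => bern_mean r (h u) s y) (bern_mean r h' s y).
Proof.
move=> dh; elim: s y => [|x s IH] y /=; first exact: dh.
have d1 := is_deriveZ r (IH (y + x)); have d2 := is_deriveZ (1 - r) (IH y).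
exact: (is_deriveD d1 d2).
Qed.

Lemma eq_bern_mean (R : realType) (r : R) (S : {pred R}) (h1 h2 : R -> R)
    (s : seq R) (y : R) :
  {in S &, forall x z, x + z \in S} -> y \in S -> {subset s <= S} ->
  {in S, h1 =1 h2} -> bern_mean r h1 s y = bern_mean r h2 s y.
Proof.
move=> addS + + h12; elim: s y => [|x s IH] y yS sS /=; first exact: h12.
have sS' : {subset s <= S} by move=> z zs; apply: sS; rewrite inE zs orbT.
by rewrite !IH //; apply: addS => //; apply: sS; rewrite inE eqxx.
Qed.

Lemma sin_int_mul_pi (R : realType) (n : int) : sin (pi * n%:~R) = 0 :> R.
Proof.
have H (k : nat) : sin (pi * k%:R) = 0 :> R.
  by rewrite mulr_natr -[_ *+ _]add0r (alternatingn (@sinDpi R)) sin0 mulr0.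
case: n => k; first exact: H.
by rewrite NegzE mulrNz mulrN sinN H oppr0.
Qed.

Section local_estimate.
Context {R : realType}.
Variables (r : R) (s : seq int) (a : int).
Hypothesis r01 : 0 < r < 1.

Let sR : seq R := [seq x%:~R | x <- s].
Let v := r * (1 - r).
Let mu := r * \sum_(x <- sR) x.
Let s2 := v * \sum_(x <- sR) x ^+ 2.
Hypothesis s2_gt0 : 0 < s2.

(** The primitive in t of cos(tz) vanishing at 0. The case z = 0 is separate, since division by 0
    yields 0. *)
Let cos_int (z t : R) : R := if z == 0 then t else sin (t * z) / z.

Let is_derive_cos_int (z t : R) : is_derive t 1 (cos_int z) (cos (t * z)).
Proof.
rewrite /cos_int; case: eqVneq => [->|z0].
  by rewrite mulr0 cos0; exact: is_derive_id.
have -> : (fun u : R => sin (u * z) / z) = z^-1 *: (fun u : R => sin (u * z)).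
  by apply/funext => u; rewrite fctE mulrC.
apply: is_derive_eq (is_deriveZ z^-1 (is_derive_mulr_comp (is_derive_sin (t * z)))) _.
by rewrite /GRing.scale /= mulKf.
Qed.

(** An explicit primitive of t -> E cos(t(Y - a)), the real part of exp(-ita) times the
    characteristic function. *)
Let F t := bern_mean r (fun z => cos_int (z - a%:~R) t) sR 0.

Let is_derive_F (t : R) :
  is_derive t 1 F (bern_mean r cos [seq t * x | x <- sR] (- (t * a%:~R))).
Proof.
have -> : bern_mean r cos [seq t * x | x <- sR] (- (t * a%:~R)) =
    bern_mean r (fun z => cos (t * (z - a%:~R))) sR 0.
  have := bern_mean_affine r cos sR t (- (t * a%:~R)) 0.
  rewrite mulr0 add0r => <-; congr bern_mean.
  by apply/funext => z; rewrite mulrBr.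
exact: is_derive_bern_mean.
Qed.

Let F0 : F 0 = 0.
Proof.
transitivity (bern_mean r (cst 0) sR 0); last exact: bern_mean_cst.
rewrite /F; congr bern_mean.
apply/funext => z; rewrite /cos_int; case: ifP => // _.
by rewrite mul0r sin0 mul0r.
Qed.

(** Fourier inversion on the lattice: at t = pi, sin(tz)/z vanishes for every nonzero integer z. *)
Let Fpi : F pi = pi * bern_mean r \1_[set a%:~R] sR 0.
Proof.
rewrite -bern_mean_scale.
apply: (@eq_bern_mean _ _ (fun x => x \is a Num.int)) => [x z|||z].
- exact: rpredD.
- exact: rpred0.
- by move=> x /mapP[k _ ->]; exact: intr_int.
move=> /intrP[k ->]; rewrite /cos_int subr_eq0 eqr_int indicE.
case: eqVneq => [->|ka]; first by rewrite mem_set // mulr1.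
rewrite memNset ?mulr0 -?intrB ?sin_int_mul_pi ?mul0r //.
by move/eqP; rewrite eqr_int; exact/negP.
Qed.

(** The absolute value meets the sign condition of [cvg_integral0_gauss_cos]; cosine being even,
    nothing changes. *)
Let x := `|mu - a%:~R|.
Let G := integral0 (gauss_cos s2 x).

Let cosx t : cos (t * x) = cos (- (t * a%:~R) + r * \sum_(z <- [seq t * x | x <- sR]) z).
Proof.
rewrite big_map -mulr_sumr mulrCA -/mu addrC -mulrBr.
rewrite -cos_norm normrM normr_id -normrM cos_norm //.
Qed.

Let gaussE t : gauss_cos s2 x t =
  cos (- (t * a%:~R) + r * \sum_(z <- [seq t * x | x <- sR]) z) *
  expR (- (r * (1 - r) * (\sum_(z <- [seq t * x | x <- sR]) z ^+ 2) / 2)).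
Proof.
rewrite /gauss_cos cosx mulrC; congr (_ * expR (- (_ / 2))).
rewrite big_map /s2 /v -mulrA [_ * t ^+ 2]mulrC; congr (_ * _).
by rewrite mulr_sumr; apply: eq_bigr => z _; rewrite exprMn.
Qed.

(** The point probability is F(pi)/pi and the Gaussian density is the limit of G(b)/pi. F - G is
    controlled by [B0] up to [T] and by decay from [T] to pi; beyond pi only G varies. *)
Lemma bern_local_estimate (T B0 B1 k : R) :
  0 <= T <= pi -> 0 < k -> 0 <= B1 ->
  (forall t, 0 < t < T -> \sum_(z <- sR) 3 * `|t * z| ^+ 3 <= B0) ->
  (forall t, T < t < pi ->
    expR (- (r * (1 - r) * \sum_(z <- sR) (1 - cos (t * z))))
    <= 2 * expR (- (k * t)) + B1) ->
  (forall t, T < t -> expR (- (s2 * t ^+ 2 / 2)) <= expR (- (k * t))) ->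
  `|bern_mean r \1_[set a%:~R] sR 0 -
    (Num.sqrt (2 * pi) * Num.sqrt s2)^-1
      * expR (- (a%:~R - mu) ^+ 2 / (2 * s2))|
  <= (T * B0 + 3 * expR (- (k * T)) / k) / pi + B1.
Proof.
move=> /andP[T0 Tpi] k0 B10 hB0 hB1 hE.
pose f t := bern_mean r cos [seq t * x | x <- sR] (- (t * a%:~R)) - gauss_cos s2 x t.
pose e (t : R) := expR (- (k * t)).
have de (t : R) : is_derive t 1 e (- (k * e t)).
  have := is_derive_mulr_comp (is_derive_expR (t * - k)).
  rewrite mulNr (_ : t * - k = - (k * t)); last by ring.
  by have -> : (fun u : R => expR (u * - k)) = e by apply/funext => u; congr expR; ring.
have dek (t : R) : is_derive t 1 (fun u => - (e u / k)) (e t).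
  have -> : (fun u => - (e u / k)) = (- k^-1) *: e.
    by apply/funext => u; rewrite fctE /GRing.scale /=; ring.
  apply: is_derive_eq (is_deriveZ (- k^-1) (de t)) _.
  by rewrite /GRing.scale /=; field; rewrite gt_eqF.
have dG (t : R) : 0 < t -> is_derive t 1 G (gauss_cos s2 x t).
  by move=> t0; apply: is_derive_integral0 => //; exact: continuous_gauss_cos.
have dFG (t : R) : 0 < t -> is_derive t 1 (fun u => F u - G u) (f t).
  by move=> t0; have ? := dG t t0; have ? := is_derive_F t; exact: is_deriveB.
have cG b : 0 <= b -> {within `[0, b], continuous G}.
  by move=> b0; apply: within_continuous_integral0 => //; exact: continuous_gauss_cos.
have cFG b : 0 <= b -> {within `[0, b], continuous (fun u => F u - G u)}.
  move=> b0 t; apply: cvgB; last exact: cG.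
  apply: derivable_within_continuous => u _.
  by have ? := is_derive_F u; exact: ex_derive.
have sub (u b : R) : 0 <= u -> `[u, b] `<=` `[0, b].
  by move=> u0; apply: subset_itvr; rewrite bnd_simp.
have gauss_le t : `|gauss_cos s2 x t| <= expR (- (s2 * t ^+ 2 / 2)).
  by rewrite /gauss_cos normrM ger0_norm ?expR_ge0 // ler_piMr ?expR_ge0 // cos_max.
have dlin (l t : R) : is_derive t 1 (fun u => u * l) l.
  by have := is_derive_expn_div 0 l^-1 t; rewrite invrK expr0 !mul1r.
have step1 : `|(F T - G T) - (F 0 - G 0)| <= T * B0 - 0 * B0.
  apply: (@ler_dist_derive R (fun u => F u - G u) (fun u => u * B0) f (fun=> B0) 0 T T0).
  - exact: cFG.
  - by apply: derivable_within_continuous => u _; have ? := dlin B0 u; exact: ex_derive.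
  - by move=> t /andP[t0 _]; exact: dFG.
  move=> t /[dup] /hB0 hB /andP[t0 _]; rewrite (le_trans _ hB) // /f gaussE.
  rewrite (le_trans (bern_mean_cos_gauss r01 _ _)) // big_map.
  by rewrite lexx.
(* The comparison function is a primitive of B1 + 3 exp(-kt): 2 exp(-kt) + B1 for the characteristic
   function, exp(-kt) for the Gaussian. *)
have step2 : `|(F pi - G pi) - (F T - G T)| <=
    (pi * B1 + 3 * - (e pi / k)) - (T * B1 + 3 * - (e T / k)).
  apply: (@ler_dist_derive R (fun u => F u - G u)
    (fun u => u * B1 + 3 * - (e u / k)) f (fun u => B1 + 3 * e u) T pi Tpi).
  - exact: continuous_subspaceW (sub _ _ T0) (cFG _ (pi_ge0 _)).
  - apply: derivable_within_continuous => u _.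
    have ? := dlin B1 u; have ? := is_deriveZ (3 : R) (dek u).
    by apply: derivableD; exact: ex_derive.
  - by move=> t /andP[Tt _]; apply: dFG; exact: le_lt_trans Tt.
  move=> t /[dup] /hB1 hB /andP[Tt _]; rewrite (le_trans (ler_normB _ _)) //.
  have := le_trans (bern_mean_cos_le r01 [seq t * x | x <- sR] (- (t * a%:~R)))
    (_ : _ <= 2 * e t + B1); rewrite big_map => /(_ hB).
  by have := le_trans (gauss_le t) (hE t Tt); rewrite -/(e t); lra.
have step3 b : pi <= b -> `|G b - G pi| <= - (e b / k) - - (e pi / k).
  move=> pib.
  apply: (@ler_dist_derive R G (fun u => - (e u / k)) (gauss_cos s2 x) e pi b pib).
  - exact: continuous_subspaceW (sub _ _ (pi_ge0 _)) (cG _ (le_trans (pi_ge0 _) pib)).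
  - by apply: derivable_within_continuous => u _; have ? := dek u; exact: ex_derive.
  - by move=> t /andP[tpi _]; apply: dG; exact: lt_trans (pi_gt0 _) tpi.
  move=> t /andP[tpi _]; apply: le_trans (gauss_le t) (hE t _).
  exact: le_lt_trans tpi.
pose C := T * B0 + 3 * e T / k + pi * B1.
have bound b : pi <= b -> `|F pi - G b| <= C.
  move=> pib; have := step3 b pib; have := step1; have := step2.
  rewrite F0 /G integral00 -/G.
  have : 0 <= e pi / k by rewrite divr_ge0 ?expR_ge0 // ltW.
  have : 0 <= e b / k by rewrite divr_ge0 ?expR_ge0 // ltW.
  have : 0 <= T * B1 by rewrite mulr_ge0.
  by rewrite /C !ler_norml => ? ? ? /andP[? ?] /andP[? ?] /andP[? ?];
    apply/andP; split; lra.
have lim := @cvg_integral0_gauss_cos R s2 s2_gt0 x (normr_ge0 _).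
set L := _ * _ in lim.
have FL : `|F pi - L| <= C.
  have h : `|F pi - G b| @[b --> +oo] --> `|F pi - L|.
    by apply: cvg_norm; apply: cvgB => //; exact: cvg_cst.
  by apply: (cvgr_to_le h); near=> b; apply: bound.
have pi0 : 0 < pi :> R := pi_gt0 R.
have LE : (Num.sqrt (2 * pi) * Num.sqrt s2)^-1
      * expR (- (a%:~R - mu) ^+ 2 / (2 * s2)) = L / pi.
  rewrite /L [RHS]mulrAC; congr (_ * expR _); last first.
    by rewrite /x real_normK ?num_real // -[a%:~R - mu]opprB sqrrN mulNr.
  rewrite -[RHS]ger0_norm; last by rewrite divr_ge0 // ltW.
  rewrite -[LHS]ger0_norm; last by rewrite invr_ge0 mulr_ge0.
  rewrite -!sqrtr_sqr; congr Num.sqrt.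
  have s20 := ltW s2_gt0.
  have h1 : 0 <= 2 * pi :> R by rewrite mulr_ge0 // ltW.
  have h2 : 0 <= pi / (2 * s2).
    apply: divr_ge0; first exact: pi_ge0.
    by apply: mulr_ge0.
  rewrite !exprMn !exprVn exprMn (sqr_sqrtr h1) (sqr_sqrtr h2) (sqr_sqrtr s20).
  move: (pi : R) pi0 s2_gt0 => p p0 s0.
  by field; rewrite !gt_eqF.
rewrite LE -(ler_pM2l pi0) -{1}(gtr0_norm pi0) -normrM mulrBr -Fpi.
rewrite [pi * (L / pi)]mulrC divfK ?gt_eqF // (le_trans FL) //.
by rewrite mulrDr [pi * (_ / pi)]mulrC divfK ?gt_eqF.
Unshelve. all: end_near. Qed.

End local_estimate.

(** * Decay of the characteristic function *)

Section characteristic_function_decay.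
Context {R : realType} (n : nat) (c : 'I_n -> R).

Lemma sum_one_sub_cos_ge_card (Q : {pred 'I_n}) (t b : R) :
  (forall i, i \in Q -> b <= 1 - cos (t * c i)) ->
  #|Q|%:R * b <= \sum_i (1 - cos (t * c i)).
Proof.
move=> Qb; rewrite (bigID (mem Q)) /= -[leLHS]addr0 lerD //.
  by rewrite mulr_natl -sumr_const ler_sum.
by rewrite sumr_ge0 // => i _; rewrite subr_ge0 cos_le1.
Qed.

(** In the application v = r(1-r), N = m^(2/3), tau = m^(-1/4), w = rho m/2 and L = ell(m). *)
Variables (v g theta kappa tau w C1 N : R) (L : nat).
Hypotheses (v_gt0 : 0 < v) (g_gt0 : 0 < g) (theta_gt0 : 0 < theta).
Hypotheses (kappa_gt0 : 0 < kappa) (C1_gt0 : 0 < C1) (N_gt0 : 0 < N).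
Hypothesis tau01 : 0 < tau <= 1.
Hypothesis c_bounds : forall i, 0 <= c i <= C1 * (N / g).
Hypothesis card_ones : w <= #|[pred i | c i == 1]|%:R.
Hypothesis card_intervals : forall k, (1 <= k <= L)%N ->
  kappa * g ^+ (3 * 2 ^ (k - 1)) <=
  #|[pred i | theta * N / (2 * g ^+ (2 ^ k)) <= c i <= theta * N / g ^+ (2 ^ k)]|%:R.
Hypothesis L_gt0 : (0 < L)%N.
Hypothesis L_large : theta * N * tau <= g ^+ (2 ^ L).

Let V t := v * \sum_i (1 - cos (t * c i)).
Let K := Num.max C1 theta.

(* If t is in the range where the k-th interval is the first one whose elements
   c satisfy t c <= 1, then with G = g^(2^(k-1)) its kappa G^3 elements give
   V t >= const * G^3 (t N / G^2)^2 = const * (t N)^2 / G, and G <= K t N. *)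
Lemma interval_decay t : 0 < t <= tau -> g <= C1 * (t * N) ->
  v * kappa * theta ^+ 2 / (16 * K) * (N * t) <= V t.
Proof.
move=> /andP[t0 ttau] gt.
have tN : theta * (t * N) <= g ^+ (2 ^ L).
  by rewrite (le_trans _ L_large) // -mulrA [N * tau]mulrC ler_pM2l // ler_pM2r.
(* The least such k is at most [L], by [L_large], so the count hypothesis applies to it. *)
pose P k := (0 < k)%N && (theta * (t * N) <= g ^+ (2 ^ k)).
have exP : exists k, P k by exists L; rewrite /P L_gt0.
case: (ex_minnP exP) => k /andP[k0 tk] kmin.
have kL : (k <= L)%N by apply: kmin; rewrite /P L_gt0.
pose G := g ^+ (2 ^ (k - 1)).
have G0 : 0 < G by rewrite exprn_gt0.
have GE : g ^+ (2 ^ k) = G ^+ 2.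
  by rewrite /G -exprM -expnSr subn1 prednK.
have u0 : 0 < t * N by rewrite mulr_gt0.
have K0 : 0 < K by rewrite lt_max C1_gt0.
(* For k > 1 this is minimality of k; for k = 1, G is g and the assumed lower bound on t takes
   over. *)
have GK : G <= K * (t * N).
  have [k1|k1] := leqP k 1.
    have k1E : k = 1%N by apply/eqP; rewrite eqn_leq k1 k0.
    have -> : G = g by rewrite /G k1E subnn expn0 expr1.
    by rewrite (le_trans gt) // ler_pM2r // le_max lexx.
  have : ~~ P (k - 1)%N by apply/negP => /kmin; rewrite leqNgt subn1 ltn_predL k0.
  rewrite /P subn_gt0 k1 /= -ltNge => /ltW h.
  by rewrite (le_trans h) // ler_pM2r // le_max lexx orbT.
have cardk := card_intervals (_ : 1 <= k <= L)%N.
rewrite k0 kL in cardk; have {cardk} := cardk isT.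
rewrite mulnC exprM -/G GE; set Q := [pred i | _]; move=> cardQ.
have low i : i \in Q -> (theta * (t * N) / (2 * G ^+ 2)) ^+ 2 / 4 <= 1 - cos (t * c i).
  rewrite inE => /andP[lo hi].
  have t1 : `|t * c i| <= 1.
    have /andP[ci0 _] := c_bounds i.
    rewrite ger0_norm ?mulr_ge0 ?(ltW t0) //.
    have := ler_wpM2l (ltW t0) hi; rewrite !mulrA => /le_trans; apply.
    rewrite ler_pdivrMr ?exprn_gt0 // mul1r -GE (le_trans _ tk) //.
    by rewrite mulrAC mulrC mulrA.
  apply: le_trans (one_sub_cos_ge t1); rewrite ler_pM2r ?invr_gt0 //.
  rewrite lerXn2r ?nnegrE //.
  - by rewrite divr_ge0 ?mulr_ge0 ?exprn_ge0 // ltW.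
  - by have /andP[ci0 _] := c_bounds i; rewrite mulr_ge0 // ltW.
  have := ler_wpM2l (ltW t0) lo; apply: le_trans.
  by rewrite le_eqVlt; apply/orP; left; apply/eqP; ring.
have := sum_one_sub_cos_ge_card low.
rewrite -(ler_pM2l v_gt0) -/(V t); apply: le_trans.
have b0 : 0 <= (theta * (t * N) / (2 * G ^+ 2)) ^+ 2 / 4.
  by rewrite divr_ge0 ?sqr_ge0.
apply: (@le_trans _ _
  (v * (kappa * G ^+ 3 * ((theta * (t * N) / (2 * G ^+ 2)) ^+ 2 / 4)))).
  have -> : v * (kappa * G ^+ 3 * ((theta * (t * N) / (2 * G ^+ 2)) ^+ 2 / 4)) =
    v * kappa * theta ^+ 2 / 16 * (t * N) * ((t * N) / G).
    by field; rewrite gt_eqF.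
  have -> : v * kappa * theta ^+ 2 / (16 * K) * (N * t) =
    v * kappa * theta ^+ 2 / 16 * (t * N) * K^-1 by field; rewrite gt_eqF.
  rewrite ler_wpM2l //.
    by rewrite !mulr_ge0 ?exprn_ge0 ?(ltW v_gt0) ?(ltW kappa_gt0) ?(ltW theta_gt0)
      ?invr_ge0 ?(ltW t0) ?(ltW N_gt0).
  by rewrite ler_pdivlMr // mulrC ler_pdivrMr // mulrC.
by rewrite ler_pM2l // ler_wpM2r.
Qed.

(** Cosine decreases on [0, pi], so 1 - cos t >= 1 - cos tau >= tau^2/4 for each index with c_i =
    1. *)
Lemma ones_decay t : tau <= t <= pi -> v * w * tau ^+ 2 / 4 <= V t.
Proof.
move=> /andP[taut tpi]; have /andP[tau0 tau1] := tau01.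
have costau : cos t <= cos tau.
  rewrite leNgt ltr_cos; first by rewrite -leNgt.
    by rewrite in_itv /= (le_trans (ltW tau0) taut) tpi.
  by rewrite in_itv /= (ltW tau0) (le_trans taut tpi).
have low i : i \in [pred i | c i == 1] -> tau ^+ 2 / 4 <= 1 - cos (t * c i).
  rewrite inE => /eqP ->; rewrite mulr1.
  have : `|tau| <= 1 by rewrite gtr0_norm.
  by move/one_sub_cos_ge => h; lra.
have := sum_one_sub_cos_ge_card low.
rewrite -(ler_pM2l v_gt0) -/(V t); apply: le_trans.
have -> : v * w * tau ^+ 2 / 4 = v * (w * (tau ^+ 2 / 4)) by ring.
by rewrite ler_pM2l // ler_wpM2r ?divr_ge0 ?sqr_ge0.
Qed.

Lemma small_decay t : 0 < t -> t * (C1 * (N / g)) <= 1 ->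
  v * (\sum_i c i ^+ 2) * t ^+ 2 / 4 <= V t.
Proof.
move=> t0 tc; rewrite /V -!mulrA ler_pM2l // mulr_suml ler_sum // => i _.
have /andP[ci0 ci1] := c_bounds i.
have t1 : `|t * c i| <= 1.
  by rewrite ger0_norm ?mulr_ge0 ?(ltW t0) // (le_trans _ tc) // ler_pM2l.
by apply: le_trans (one_sub_cos_ge t1); rewrite exprMn; lra.
Qed.

(** Each range of t is covered by one of the three terms; their sum is a single bound on all of ]0,
    pi[, as [bern_local_estimate] requires. *)
Lemma characteristic_decay t : 0 < t < pi ->
  expR (- V t) <= expR (- (v * (\sum_i c i ^+ 2) * t ^+ 2 / 4))
    + expR (- (v * kappa * theta ^+ 2 / (16 * K) * (N * t)))
    + expR (- (v * w * tau ^+ 2 / 4)).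
Proof.
move=> /andP[t0 tpi].
have max3 (x y z u : R) : x <= y \/ x <= z \/ x <= u ->
    expR x <= expR y + expR z + expR u.
  have := expR_gt0 y; have := expR_gt0 z; have := expR_gt0 u.
  by move=> ? ? ? [|[]]; rewrite -ler_expR; lra.
apply: max3; rewrite !lerN2.
have [tc|tc] := leP (t * (C1 * (N / g))) 1; first by left; exact: small_decay.
have [ttau|ttau] := leP t tau; right; [left|right].
  apply: interval_decay; first by rewrite t0.
  move: tc; rewrite !mulrA ltr_pdivlMr // mul1r => /ltW /le_trans; apply.
  by rewrite [t * C1]mulrC.
by apply: ones_decay; rewrite !ltW.
Qed.

End characteristic_function_decay.

(** * A quantitative local limit theorem *)

Section quantitative_local_limit.
Context {R : realType} (r : R) (n : nat) (c : 'I_n -> int).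
Variables (g theta kappa tau w C1 C3 N A : R) (L : nat).
Hypotheses (r01 : 0 < r < 1) (g_gt0 : 0 < g) (theta_gt0 : 0 < theta).
Hypotheses (kappa_gt0 : 0 < kappa) (C1_gt0 : 0 < C1) (N_gt0 : 0 < N).
Hypothesis tau01 : 0 < tau <= 1.
Hypothesis c_bounds : forall i, 0 <= ((c i)%:~R : R) <= C1 * (N / g).
Hypothesis card_ones : w <= #|[pred i | (c i)%:~R == 1 :> R]|%:R.
Hypothesis card_intervals : forall k, (1 <= k <= L)%N ->
  kappa * g ^+ (3 * 2 ^ (k - 1)) <=
  #|[pred i | theta * N / (2 * g ^+ (2 ^ k)) <= (c i)%:~R
              <= theta * N / g ^+ (2 ^ k)]|%:R.
Hypothesis L_gt0 : (0 < L)%N.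
Hypothesis L_large : theta * N * tau <= g ^+ (2 ^ L).

Let v := r * (1 - r).
Let q : R := \sum_i (c i)%:~R ^+ 2.
Let s := Num.sqrt (v * q).
Hypothesis C3_gt0 : 0 < C3.
Hypothesis q_le : v * q <= (C3 * N) ^+ 2.
Hypothesis A_ge1 : 1 <= A.
Hypothesis A_le : A <= s.

Let K := Num.max C1 theta.
(** A rate in the variable st: 1/4 comes from the Gaussian terms, where st >= A >= 1, the other
    entry from [interval_decay] and s <= C3 N. *)
Definition decay_rate : R :=
  Num.min (1 / 4) (v * kappa * theta ^+ 2 / (16 * K) / C3).

Let v_gt0 : 0 < v.
Proof. by case/andP: r01 => r0 r1; rewrite mulr_gt0 // subr_gt0. Qed.

Let s_gt0 : 0 < s.
Proof. by apply: lt_le_trans A_le; exact: lt_le_trans A_ge1. Qed.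

Let vq_gt0 : 0 < v * q. Proof. by move: s_gt0; rewrite sqrtr_gt0. Qed.

Let s_sqr : s ^+ 2 = v * q. Proof. by rewrite sqr_sqrtr // ltW. Qed.

Lemma decay_rate_gt0 : 0 < decay_rate.
Proof.
have K0 : 0 < K by rewrite lt_max C1_gt0.
rewrite lt_min divr_gt0 //=; apply: divr_gt0 => //; apply: divr_gt0.
  by apply: mulr_gt0; [exact: mulr_gt0 | exact: exprn_gt0].
exact: mulr_gt0.
Qed.

Let s_le : s <= C3 * N.
Proof.
by rewrite -(ler_pXn2r (_ : 0 < 2)%N) ?nnegrE ?(ltW s_gt0) ?mulr_ge0 ?(ltW C3_gt0)
  ?(ltW N_gt0) // s_sqr.
Qed.

(** [bern_local_estimate] with cutoff T = A/s and rate [decay_rate] times s. The cubic sum is at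
    most the largest c_i times [q], and q = s^2/v leaves one factor 1/s in front. *)
Lemma quantitative_local_limit (a : int) :
  `|bern_mean r \1_[set a%:~R] [seq (c i)%:~R | i <- enum 'I_n] 0 -
    (Num.sqrt (2 * pi) * s)^-1
      * expR (- (a%:~R - r * \sum_i (c i)%:~R) ^+ 2 / (2 * (v * q)))|
  <= (3 * A ^+ 4 * C1 / v * (N / (g * s))
       + 3 * expR (- (decay_rate * A)) / decay_rate) / s
     + expR (- (v * w * tau ^+ 2 / 4)).
Proof.
set k := decay_rate; have k0 : 0 < k by exact: decay_rate_gt0.
have k4 : k <= 1 / 4 by rewrite /k /decay_rate ge_min lexx.
have T0 : 0 < A / s by rewrite divr_gt0 // (lt_le_trans _ A_ge1).
have T1 : A / s <= pi.
  by rewrite (@le_trans _ _ 1) ?ler_pdivrMr ?mul1r // (le_trans _ (pi_ge2 R)) // ler1n.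
have sT t : A / s < t -> A <= s * t.
  by rewrite ltr_pdivrMr // mulrC => /ltW.
have cE : [seq (c i)%:~R | i <- enum 'I_n] =
    [seq x%:~R | x <- map c (enum 'I_n)] :> seq R.
  by rewrite -map_comp.
have sumE (f : R -> R) : \sum_(x <- [seq x%:~R | x <- map c (enum 'I_n)]) f x =
    \sum_i f (c i)%:~R.
  by rewrite -cE big_map big_enum.
have := @bern_local_estimate R r (map c (enum 'I_n)) a r01.
rewrite -[r * (1 - r)]/v !sumE -/q => /(_ vq_gt0 (A / s)
  (3 * (A / s) ^+ 3 * (C1 * (N / g) * q)) (expR (- (v * w * tau ^+ 2 / 4))) (k * s)).
rewrite -cE => h; apply: le_trans (h _ _ _ _ _ _) _ => {h}.
- by rewrite (ltW T0) T1.
- by rewrite mulr_gt0.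
- exact: expR_ge0.
- move=> t /andP[t0 tT]; rewrite cE sumE /q !mulr_sumr ler_sum // => i _.
  have /andP[ci0 ciC] := c_bounds i.
  rewrite normrM !ger0_norm ?(ltW t0) // -mulrA ler_pM2l // exprMn.
  rewrite ler_pM ?exprn_ge0 ?(ltW t0) //; first by rewrite lerXn2r ?nnegrE ?ltW.
  by rewrite exprS mulrC [leRHS]mulrC ler_wpM2l ?sqr_ge0.
- move=> t /andP[Tt tpi]; have t0 := lt_trans T0 Tt; rewrite cE sumE.
  have := @characteristic_decay R n (fun i => (c i)%:~R) v g theta kappa tau w C1 N L
    v_gt0 g_gt0 theta_gt0 kappa_gt0 C1_gt0 N_gt0 tau01 c_bounds card_ones
    card_intervals L_gt0 L_large t.
  rewrite t0 tpi => /(_ isT) /le_trans; apply; rewrite lerD2r.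
  rewrite [2 * _]mulr_natl mulr2n; apply: lerD; rewrite ler_expR lerN2.
    rewrite -/q -s_sqr; have := sT _ Tt => st.
    rewrite -exprMn -mulrA; have : k * (s * t) <= 1 / 4 * (s * t).
      by rewrite ler_wpM2r // mulr_ge0 // ltW.
    by have := A_ge1; nra.
  rewrite -mulrA; apply: (@le_trans _ _ (k * (C3 * (N * t)))).
    by rewrite ler_pM2l // mulrA ler_pM2r.
  rewrite mulrA ler_pM2r ?mulr_gt0 // -ler_pdivlMr //.
  by rewrite /k /decay_rate ge_min lexx orbT.
- move=> t Tt; have := sT _ Tt => st; rewrite ler_expR lerN2 -/v -s_sqr.
  rewrite -exprMn -mulrA; have : k * (s * t) <= 1 / 4 * (s * t).
    by rewrite ler_wpM2r // (le_trans _ st) // (le_trans _ A_ge1).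
  by have := A_ge1; nra.
rewrite lerD2r ler_pdivrMr ?pi_gt0 //.
have -> : A / s * (3 * (A / s) ^+ 3 * (C1 * (N / g) * q)) +
    3 * expR (- (k * s * (A / s))) / (k * s) =
    (3 * A ^+ 4 * C1 / v * (N / (g * s)) + 3 * expR (- (k * A)) / k) / s.
  rewrite (_ : k * s * (A / s) = k * A); last by field; rewrite gt_eqF.
  rewrite (_ : q = s ^+ 2 / v); last by rewrite s_sqr mulrC mulKf ?gt_eqF.
  by field; rewrite !gt_eqF.
rewrite ler_peMr //; last by rewrite (le_trans _ (pi_ge2 R)) // ler1n.
rewrite divr_ge0 ?(ltW s_gt0) // addr_ge0 //.
  have A0 : 0 <= A by rewrite (le_trans _ A_ge1).
  apply: mulr_ge0; last by rewrite divr_ge0 ?mulr_ge0 // ltW.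
  by rewrite !mulr_ge0 ?exprn_ge0 ?invr_ge0 // ltW.
by rewrite divr_ge0 ?mulr_ge0 ?expR_ge0 // ltW.
Qed.

End quantitative_local_limit.

(** * Asymptotics *)

Lemma card_ord_lt (m k : nat) : (k <= m)%N -> #|[pred i : 'I_m | (i < k)%N]| = k.
Proof.
move=> km; rewrite -sum1_card -[RHS]card_ord -sum1_card.
by rewrite (big_ord_widen m (fun=> 1%N) km).
Qed.

(** The third power suffices: s = O(y^4) will be multiplied by exp(-beta y^2), which is
    O(y^(-6)). *)
Lemma expRN_le_cube (R : realType) (x : R) : 0 < x -> expR (- x) <= 6 / x ^+ 3.
Proof.
move=> x0; have := expR_ge1Dxn 2 (ltW x0); rewrite -[3`!]/6%N => h.
rewrite expRN -[6 / _]invf_div lef_pV2 ?posrE ?expR_gt0 ?divr_gt0 ?exprn_gt0 //.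
by lra.
Qed.

Lemma powR_expn (R : realType) (x : R) (p q : R) (k : nat) :
  0 <= x -> p * k%:R = q -> (x `^ p) ^+ k = x `^ q.
Proof. by move=> x0 <-; rewrite powRrM powR_mulrn ?powR_ge0. Qed.

(* The asymptotics are for m tending to infinity in an infinite set M of
   integers; M = setT is the case where m runs through all integers. The set M
   matters: along all integers the hypotheses on the counts cannot hold
   together. Indeed ell(m) tends to infinity, and whenever it exceeds ell(m-1)
   one has g(m)^(2^ell(m)) >= (m-1)^(5/6), so that calI theta g (ell m) m lies
   in ]0, 1[ for large m and contains no integer.
   The indices i of c m i and X m i range over 1 <= i <= m; values outside this
   range are irrelevant. The constant kappa in the Omega bound on the counts is
   uniform in k. *)
Theorem theorem5p1 (R : realType) (theta r rho : R)
    (M : set nat) (g delta : nat -> R) (ell : nat -> nat)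
    (c : nat -> nat -> int)
    (d : nat -> measure_display) (T : forall m, measurableType (d m))
    (P : forall m, probability (T m) R)
    (X : forall m : nat, nat -> {RV (P m) >-> R}) :
  0 < theta -> 0 < r < 1 -> 0 < rho < 1 ->
  infinite_set M ->
  (forall m, 0 < g m) ->
  {homo g : m n / (m <= n)%N >-> m <= n} ->
  g m @[m --> \oo] --> +oo ->
  g =o_\oo (fun m => ln m%:R) ->
  (forall m, M m ->
    [/\ forall i j, (1 <= i)%N -> (i <= j)%N -> (j <= m)%N -> c m i <= c m j,
        forall i, (1 <= i <= m)%N -> i%:R <= rho * m%:R -> c m i = 1,
        forall i, (1 <= i <= m)%N -> two_point_law r (c m i)%:~R (X m i)
      & mutually_independent (fun i : 'I_m => X m i.+1)]) ->
  (fun m => (c m m)%:~R : R) =O_ (within M \oo)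
    (fun m => m%:R `^ (2 / 3) / g m) ->
  (fun m => \sum_(1 <= i < m.+1) (c m i)%:~R ^+ 2 : R) =O_ (within M \oo)
    (fun m => m%:R `^ (4 / 3) / Num.sqrt (g m)) ->
  delta m @[m --> within M \oo] --> (0 : R) ->
  (\forall m \near within M \oo, is_ell g delta m (ell m)) ->
  (exists2 kappa : R, 0 < kappa &
    \forall m \near within M \oo, forall k, (1 <= k <= ell m)%N ->
      kappa * g m ^+ (3 * 2 ^ (k - 1)) <=
        #|[pred i : 'I_m | (c m i.+1)%:~R \in calI theta g k m]|%:R) ->
  local_limit_theorem (within M \oo) P
    (fun m w => \sum_(1 <= i < m.+1) X m i w).
Proof.
move=> theta0 r01 /andP[rho0 rho1] infM g0 gmono goo _ struct.
move=> /eqO_exP[C1 C10 cmO] /eqO_exP[C2 C20 sumO] delta0 ellP [kappa kappa0 cards].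
move=> e e0.

(* Constants and thresholds, independent of m and a *)
have /andP[r0 r1] := r01.
pose v := r * (1 - r).
have v0 : 0 < v by rewrite mulr_gt0 // subr_gt0.
pose C3 := Num.sqrt (v * C2).
have C30 : 0 < C3 by rewrite sqrtr_gt0 mulr_gt0.
pose k := decay_rate r theta kappa C1 C3.
have k0 : 0 < k by exact: decay_rate_gt0.
(* A makes the contribution of t >= A / sigma small; once A is fixed, the two
   other error terms vanish as m grows. *)
have [A A1 Ae] : exists2 A : R, 1 <= A & 3 * expR (- (k * A)) / k <= e / 3.
  (* From exp(-u) <= 1/u the left side is at most 3/(k^2 A), which is at most e/3 once A >= 9/(k^2
     e). *)
  exists (Num.max 1 (9 / (k ^+ 2 * e))); first by rewrite le_max lexx.
  set A := Num.max _ _; have Ake : 9 / (k ^+ 2 * e) <= A by rewrite le_max lexx orbT.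
  have kA0 : 0 < k * A by rewrite mulr_gt0 // (lt_le_trans ltr01) // le_max lexx.
  have : expR (- (k * A)) <= (k * A)^-1.
    by rewrite expRN lef_pV2 ?posrE ?expR_gt0 // (le_trans _ (expR_ge1Dx _)) // lerDr.
  rewrite ler_pdivrMr // => h.
  rewrite (le_trans (ler_wpM2l _ h)) // ler_pdivrMr //.
  move: Ake; rewrite ler_pdivrMr ?mulr_gt0 ?exprn_gt0 // => Ake.
  by nra.
pose D := 3 * A ^+ 4 * C1 / v.
have A0 : 0 < A by exact: lt_le_trans A1.
have D0 : 0 < D by apply: divr_gt0 => //; rewrite !mulr_gt0 ?exprn_gt0.
have [eta eta0 Deta] : exists2 eta : R, 0 < eta & D * eta = e / 3.
  exists (e / (3 * D)); first by apply: divr_gt0 => //; exact: mulr_gt0.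
  by field; rewrite gt_eqF.
(* Chosen so that the exponent from the indices with c_i = 1 is beta m^(1/2). *)
have [beta beta0 betaE] : exists2 beta : R, 0 < beta & beta = v * rho / 8.
  by exists (v * rho / 8) => //; apply: divr_gt0 => //; exact: mulr_gt0.
pose Y := Num.max 1 (C3 * 6 / (beta ^+ 3 * (e / 3))).
have lift (Q : nat -> Prop) : (\forall m \near \oo, Q m) ->
    \forall m \near within M \oo, Q m.
  by move=> h; rewrite near_withinE; apply: filterS h => m Qm _.
have inM : \forall m \near within M \oo, M m by rewrite near_withinE; exact: nearW.
(* In turn: rho m >= 2 gives enough ones, m >= A^2/v gives A <= s, and the last gives Y <=
   m^(1/4). *)
have m_large := lift _ (nbhs_infty_ger
  (Num.max (2 / rho) (Num.max (A ^+ 2 / v) (Y ^+ 4)))).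
(* As s^2 >= v kappa theta^2 N^2/(4g), by the first interval, this makes N/(gs) <= eta. *)
have g_large : \forall m \near within M \oo,
    Num.max 1 (4 / (v * kappa * theta ^+ 2 * eta ^+ 2)) <= g m.
  by apply: lift; exact: ((cvgryPge _).1 goo).
have theta'0 : 0 < theta^-1 by rewrite invr_gt0.
(* This level gives theta delta(m) <= 1, which turns smallness at ell(m) into [L_large]. *)
have delta_small : \forall m \near within M \oo, `|0 - delta m| <= theta^-1.
  exact: ((cvgrPdist_le _ _).1 delta0).
near=> m => a.
have Mm : M m by near: m.
have : Num.max (2 / rho) (Num.max (A ^+ 2 / v) (Y ^+ 4)) <= m%:R.
  by near: m.
rewrite ge_max => /andP[m_rho].
rewrite ge_max => /andP[m_A m_Y].
have : Num.max 1 (4 / (v * kappa * theta ^+ 2 * eta ^+ 2)) <= g m by near: m.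
rewrite ge_max => /andP[g_ge1 g_ge].
have [cmono cone claw cindep] := struct m Mm.
have cm_le : `|(c m m)%:~R : R| <= C1 * `|m%:R `^ (2 / 3) / g m| by near: m.
have q_bound : `|\sum_(1 <= i < m.+1) (c m i)%:~R ^+ 2 : R| <=
  C2 * `|m%:R `^ (4 / 3) / Num.sqrt (g m)| by near: m.
have [L0 Lsmall _] : is_ell g delta m (ell m) by near: m.
have cards_m : forall k, (1 <= k <= ell m)%N ->
  kappa * g m ^+ (3 * 2 ^ (k - 1)) <=
    #|[pred i : 'I_m | (c m i.+1)%:~R \in calI theta g k m]|%:R by near: m.
have dle : `|0 - delta m| <= theta^-1 by near: m.

(* The hypotheses at a fixed large m *)
have m1 : 1 <= m%:R :> R.
  by rewrite (le_trans _ m_Y) // exprn_ege1 // le_max lexx.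
have m_gt0 : 0 < m%:R :> R by exact: lt_le_trans m1.
set G := g m in g_ge1 g_ge cm_le q_bound Lsmall cards_m.
have G0 : 0 < G by exact: g0.
set N := m%:R `^ (2 / 3) in cm_le Lsmall.
have N0 : 0 < N by exact: powR_gt0.
have N2 : m%:R `^ (4 / 3) = N ^+ 2.
  by rewrite (@powR_expn _ _ _ (4 / 3)) ?ler0n //; field.
rewrite {}N2 in q_bound.
set y := m%:R `^ (1 / 4) in Lsmall.
have y0 : 0 < y by exact: powR_gt0.
have y4 : y ^+ 4 = m%:R.
  by rewrite (@powR_expn _ _ _ 1) ?powRr1 ?ler0n //; field.
have Nm : N <= y ^+ 4.
  by rewrite y4 -[leRHS]powRr1 ?ler0n // ler_powR //; lra.
have Yy : Y <= y.
  rewrite -(ler_pXn2r (_ : 0 < 4)%N) ?nnegrE ?(ltW y0) ?y4 //.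
  by rewrite le_max ler01.
have y1 : 1 <= y by apply: le_trans Yy; rewrite le_max lexx.
have mN : (0 < m)%N by rewrite -(ltr_nat R).
have rhom : 2 <= rho * m%:R by rewrite mulrC -ler_pdivrMr.
(* Since rho m >= 1, c_1 = 1, and monotonicity does the rest; in particular no c_i is 0. *)
have c1 i : (1 <= i <= m)%N -> 1 <= c m i.
  move=> /andP[i1 im]; rewrite -(cone 1%N) ?mN //; first exact: cmono.
  by rewrite (le_trans _ rhom) // ler1n.
pose ci (i : 'I_m) := c m i.+1.
have ci1 i : 1 <= (ci i)%:~R :> R by rewrite ler1z; apply: c1; rewrite /= ltn_ord.
have ci0 i : 0 <= (ci i)%:~R :> R by exact: le_trans (ci1 i).
have ci_neq0 i : (ci i)%:~R != 0 :> R by rewrite gt_eqF // (lt_le_trans _ (ci1 i)).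
have c_bounds i : 0 <= ((ci i)%:~R : R) <= C1 * (N / G).
  have NG0 : 0 <= N / G by rewrite divr_ge0 ?ltW.
  rewrite ci0 /= -(ger0_norm NG0); apply: le_trans cm_le.
  by apply: le_trans (ler_norm _); rewrite ler_int cmono.
have card_ones : rho * m%:R / 2 <= #|[pred i | (ci i)%:~R == 1 :> R]|%:R.
  have rm0 : 0 <= rho * m%:R by rewrite (le_trans _ rhom).
  have /andP[t1 t2] := truncn_itv rm0.
  set j := Num.trunc (rho * m%:R) in t1 t2.
  have jm : (j <= m)%N.
    by rewrite -(ler_nat R) (le_trans t1) // ler_piMl // ltW.
  (* Truncation loses less than 1, at most half of rho m because rho m >= 2. *)
  apply: (@le_trans _ _ j%:R); first by move: t2; rewrite -natr1; lra.
  rewrite ler_nat -{1}(card_ord_lt jm); apply: subset_leq_card.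
  apply/fintype.subsetP => i; rewrite !inE => ij.
  suff -> : ci i = 1 by [].
  by apply: cone; rewrite /= ?ltn_ord // (le_trans _ t1) // ler_nat.
have card_intervals j : (1 <= j <= ell m)%N ->
    kappa * G ^+ (3 * 2 ^ (j - 1)) <=
    #|[pred i | theta * N / (2 * G ^+ (2 ^ j)) <= (ci i)%:~R
                <= theta * N / G ^+ (2 ^ j)]|%:R.
  by move=> jl; rewrite (le_trans (cards_m j jl)) // ler_nat subset_leq_card //;
    apply/fintype.subsetP => i; rewrite !inE /calI in_itv.
have L_large : theta * N * y^-1 <= G ^+ (2 ^ ell m).
  have GL0 : 0 < G ^+ (2 ^ ell m) by rewrite exprn_gt0.
  have theta_delta : theta * delta m <= 1.
    rewrite mulrC -ler_pdivlMr // mul1r (le_trans _ dle) //.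
    by rewrite sub0r normrN ler_norm.
  move: Lsmall; rewrite ler_pdivrMr // => Lsmall.
  rewrite ler_pdivrMr // (le_trans (ler_wpM2l (ltW theta0) Lsmall)) //.
  set GL := G ^+ _ in GL0 *.
  have -> : theta * (delta m * y * GL) = theta * delta m * (GL * y) by ring.
  by rewrite ler_piMl // mulr_ge0 // ltW.
pose q : R := \sum_(i < m) (ci i)%:~R ^+ 2.
have qE : \sum_(1 <= i < m.+1) (c m i)%:~R ^+ 2 = q :> R.
  by rewrite big_add1 big_mkord.
rewrite {}qE in q_bound.
have q_ge_m : m%:R <= q.
  rewrite -[m in m%:R]card_ord -sum1_card natr_sum ler_sum // => i _.
  by rewrite exprn_ege1.
have q_le : v * q <= (C3 * N) ^+ 2.
  rewrite exprMn sqr_sqrtr; last by rewrite mulr_ge0 // ltW.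
  rewrite -[v * C2 * _]mulrA ler_pM2l // (le_trans (ler_norm _)) // (le_trans q_bound) //.
  rewrite ler_pM2l // ger0_norm ?divr_ge0 ?sqr_ge0 //.
  rewrite ler_pdivrMr ?sqrtr_gt0 // ler_peMr ?sqr_ge0 //.
  by rewrite -[leLHS]sqrtr1 ler_wsqrtr.
(* Only the first interval is kept: at least kappa g^3 elements, each at least theta N/(2g^2). *)
have q_ge : v * kappa * theta ^+ 2 * N ^+ 2 / (4 * G) <= v * q.
  have /card_intervals : (1 <= 1 <= ell m)%N by rewrite L0.
  rewrite subnn expn0 muln1 expn1; set Q := [pred i | _] => cardQ.
  pose lo := theta * N / (2 * G ^+ 2).
  have lo0 : 0 <= lo by rewrite divr_ge0 ?mulr_ge0 ?exprn_ge0 // ltW.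
  apply: (@le_trans _ _ (v * (kappa * G ^+ 3 * lo ^+ 2))).
    by rewrite /lo le_eqVlt; apply/orP; left; apply/eqP; field; rewrite gt_eqF.
  rewrite ler_pM2l // (le_trans (ler_wpM2r (sqr_ge0 lo) cardQ)) //.
  rewrite /q (bigID (mem Q)) /= -[leLHS]addr0 lerD //; last first.
    by rewrite sumr_ge0 // => i _; rewrite sqr_ge0.
  rewrite mulr_natl -sumr_const ler_sum // => i; rewrite inE => /andP[loi _].
  by rewrite lerXn2r ?nnegrE.
pose s := Num.sqrt (v * q).
have A_le : A <= s.
  rewrite -[A]gtr0_norm // -sqrtr_sqr ler_wsqrtr //.
  by move: m_A; rewrite ler_pdivrMr // mulrC => /le_trans; apply; rewrite ler_pM2l.
have s0 : 0 < s by exact: lt_le_trans A_le.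
have s2 : s ^+ 2 = v * q.
  by rewrite sqr_sqrtr // mulr_ge0 ?(ltW v0) // (le_trans _ q_ge_m).
have tau01 : 0 < y^-1 <= 1 by rewrite invr_gt0 y0 invf_le1.
have main := quantitative_local_limit r01 G0 theta0 kappa0 C10 N0 tau01 c_bounds
  card_ones card_intervals L0 L_large C30 q_le A1 A_le a.

(* Transfer to S_m and the error terms *)
have SE : (fun w => \sum_(1 <= i < m.+1) X m i w) =
    (fun w => \sum_(i < m) (X m i.+1 : T m -> R) w).
  by apply/funext => w; rewrite big_add1 big_mkord.
have law (i : 'I_m) : two_point_law r (ci i)%:~R (X m i.+1).
  by apply: claw; rewrite /= ltn_ord.
have sumE (f : R -> R) : \sum_(x <- [seq (ci i)%:~R | i <- enum 'I_m]) f x =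
    \sum_i f (ci i)%:~R by rewrite big_map big_enum.
rewrite SE (expectation_bern_sum ci_neq0 law cindep)
  (variance_bern_sum ci_neq0 law cindep)
  (probability_bern_sum ci_neq0 law cindep) !sumE /= -/q -/v -/s s2.
apply: le_trans main _.
have Ns : N / (G * s) <= eta.
  have p0 : 0 < v * kappa * theta ^+ 2 by rewrite mulr_gt0 ?exprn_gt0 // mulr_gt0.
  have vq0 : 0 < v * q by rewrite -s2 exprn_gt0.
  rewrite -(ler_pXn2r (_ : 0 < 2)%N) ?nnegrE ?(ltW eta0) //; last first.
    by rewrite divr_ge0 ?(ltW N0) // mulr_ge0 // ltW.
  rewrite expr_div_n exprMn s2.
  move: (v * kappa * theta ^+ 2) (v * q) p0 vq0 g_ge q_ge => p w p0 w0.
  rewrite ler_pdivrMr ?mulr_gt0 ?exprn_gt0 // => g_ge.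
  rewrite ler_pdivrMr ?mulr_gt0 // => q_ge.
  rewrite ler_pdivrMr ?mulr_gt0 ?exprn_gt0 // -(ler_pM2l p0) (le_trans q_ge) //.
  have -> : p * (eta ^+ 2 * (G ^+ 2 * w)) = w * (G * (p * eta ^+ 2) * G) by ring.
  by rewrite ler_pM2l // ler_pM2r.
(* With y = m^(1/4), s <= C3 y^4 and the cubic bound on the exponential leave a multiple of y^(-2);
   [Y] was chosen for this. *)
have small : s * expR (- (v * (rho * m%:R / 2) * y^-1 ^+ 2 / 4)) <= e / 3.
  have -> : v * (rho * m%:R / 2) * y^-1 ^+ 2 / 4 = beta * y ^+ 2.
    by rewrite -y4 betaE; field; rewrite gt_eqF.
  have by0 : 0 < beta * y ^+ 2 by rewrite mulr_gt0 ?exprn_gt0.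
  apply: (@le_trans _ _ (C3 * y ^+ 4 * (6 / (beta * y ^+ 2) ^+ 3))).
    apply: ler_pM; rewrite ?expR_ge0 ?(ltW s0) ?expRN_le_cube //.
    apply: (@le_trans _ _ (C3 * N)); last by rewrite ler_pM2l.
    have CN0 : 0 < C3 * N by exact: mulr_gt0.
    by rewrite -[leRHS]gtr0_norm // -sqrtr_sqr ler_wsqrtr.
  have -> : C3 * y ^+ 4 * (6 / (beta * y ^+ 2) ^+ 3) = C3 * 6 / beta ^+ 3 / y ^+ 2.
    by field; rewrite !gt_eqF.
  have : C3 * 6 / (beta ^+ 3 * (e / 3)) <= y.
    by apply: le_trans Yy; rewrite le_max lexx orbT.
  have be0 : 0 < beta ^+ 3 by rewrite exprn_gt0.
  have C36 : 0 < C3 * 6 by rewrite mulr_gt0.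
  rewrite ler_pdivrMr ?mulr_gt0 ?divr_gt0 // => Cy.
  rewrite -mulrA -invfM ler_pdivrMr ?mulr_gt0 ?exprn_gt0 // (le_trans Cy) //.
  have -> : e / 3 * (beta ^+ 3 * y ^+ 2) = y * (y * (beta ^+ 3 * (e / 3))) by ring.
  rewrite ler_peMl // !mulr_ge0 // ltW // divr_gt0 //.
rewrite -/v -/q -/s -/k -/D.
have -> : e / s = (e / 3 + e / 3) / s + e / 3 / s by field; rewrite gt_eqF.
rewrite lerD //; last by rewrite ler_pdivlMr // mulrC.
rewrite ler_pM2r ?invr_gt0 // lerD //.
by rewrite (le_trans (ler_wpM2l (ltW D0) Ns)) // Deta.
Unshelve. all: end_near. Qed.
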